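(* The problem \textsc{$(r,\ell)$wc-g} can be solved in polynomial time for $(r,\ell) \in \{(0,1),(0,2),(1,0),(1,1),(1,2),(2,0)\}$, and the problem \textsc{wc-$(r,\ell)$g} can be solved in polynomial time whenever $r \in \{0,1\}$ (for any fixed $\ell\ge 0$) or $(r,\ell)=(2,0)$.
   Context: All graphs are finite and simple. An $(r,\ell)$-partition of a graph $G$ is a partition of $V(G)$ into $r$ independent sets and $\ell$ cliques (parts may be empty); $G$ is an $(r,\ell)$-graph if it admits one. A graph is well-covered if all its maximal independent sets have the same cardinality; it is $(r,\ell)$-well-covered if it is both an $(r,\ell)$-graph and well-covered. For fixed $r,\ell$: \textsc{$(r,\ell)$wc-g} takes as input a graph $G$ and asks whether $G$ is $(r,\ell)$-well-covered; \textsc{wc-$(r,\ell)$g} takes as input an $(r,\ell)$-graph $G$ together with an $(r,\ell)$-partition of $V(G)$ and asks whether $G$ is well-covered. *)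

(* Defs.v *)
From mathcomp Require Import all_boot.
Set Implicit Arguments. Unset Strict Implicit. Unset Printing Implicit Defensive.

Definition simple_graph (n : nat) (adj : 'I_n -> 'I_n -> bool) : Prop :=
  (forall u v, adj u v = adj v u) /\ (forall u, adj u u = false).

Definition independent n (adj : 'I_n -> 'I_n -> bool) (S : {set 'I_n}) : bool :=
  [forall u in S, forall v in S, ~~ adj u v].

Definition clique n (adj : 'I_n -> 'I_n -> bool) (S : {set 'I_n}) : bool :=
  [forall u in S, forall v in S, (u != v) ==> adj u v].

Definition maximal_independent n (adj : 'I_n -> 'I_n -> bool) (S : {set 'I_n}) : bool :=
  independent adj S &&
  [forall T : {set 'I_n}, (S \proper T) ==> ~~ independent adj T].

Definition well_covered n (adj : 'I_n -> 'I_n -> bool) : Prop :=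
  forall S T : {set 'I_n}, maximal_independent adj S -> maximal_independent adj T ->
    #|S| = #|T|.

(* An (r,l)-partition is given by a labelling of the vertices with r+l
   labels: the vertices with label i < r form the i-th independent set,
   those with label r + j form the j-th clique (parts may be empty). *)
Definition part n (r l : nat) (f : 'I_n -> 'I_(r + l)) (i : nat) : {set 'I_n} :=
  [set v | val (f v) == i].

Definition is_rl_partition n (adj : 'I_n -> 'I_n -> bool) (r l : nat)
    (f : 'I_n -> 'I_(r + l)) : Prop :=
  (forall i, i < r -> independent adj (part f i)) /\
  (forall j, j < l -> clique adj (part f (r + j))).

Arguments is_rl_partition [n] adj r l f.

Definition rl_graph n (adj : 'I_n -> 'I_n -> bool) (r l : nat) : Prop :=
  exists f : 'I_n -> 'I_(r + l), is_rl_partition adj r l f.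

Definition rl_well_covered n (adj : 'I_n -> 'I_n -> bool) (r l : nat) : Prop :=
  rl_graph adj r l /\ well_covered adj.

(* Input encodings (binary strings).                                       *)
(*  - a graph on 'I_n is encoded by its adjacency matrix, row by row       *)
(*    (n^2 bits);                                                          *)
(*  - a graph with a labelling f : 'I_n -> 'I_(r+l) is encoded by the      *)
(*    adjacency matrix followed, for each vertex v in order, by the        *)
(*    one-hot vector of length r+l of its label  (n^2 + n(r+l) bits; n is  *)
(*    determined by the length).                                           *)

Definition enc_graph n (adj : 'I_n -> 'I_n -> bool) : seq bool :=
  [seq adj u v | u <- enum 'I_n, v <- enum 'I_n].

Definition enc_labelled n (adj : 'I_n -> 'I_n -> bool) (r l : nat)
    (f : 'I_n -> 'I_(r + l)) : seq bool :=
  enc_graph adj ++ flatten [seq [seq (f v == k) | k <- enum 'I_(r + l)] | v <- enum 'I_n].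
Arguments enc_labelled [n] adj r l f.

Unset Implicit Arguments.
Record TM := {
  tm_state : finType;
  tm_sym : finType;
  tm_blank : tm_sym;
  tm_in : bool -> tm_sym;
  tm_start : tm_state;
  tm_halt : pred tm_state;
  tm_accept : pred tm_state;
  tm_delta : tm_state -> tm_sym -> tm_state * tm_sym * bool (* true = move right *)
}.

Set Implicit Arguments.

(* configuration: state, reversed left part of tape, scanned symbol, right part *)
Definition config (M : TM) : Type :=
  (tm_state M * seq (tm_sym M) * tm_sym M * seq (tm_sym M))%type.

Definition tm_init (M : TM) (w : seq bool) : config M :=
  match w with
  | [::] => (tm_start M, [::], tm_blank M, [::])
  | b :: w' => (tm_start M, [::], tm_in M b, map (tm_in M) w')
  end.

Definition tm_step (M : TM) (c : config M) : config M :=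
  let: (q, L, h, R) := c in
  if tm_halt M q then c else
  let: (q', s, mvR) := tm_delta M q h in
  if mvR then
    match R with
    | [::] => (q', s :: L, tm_blank M, [::])
    | x :: R' => (q', s :: L, x, R')
    end
  else
    match L with
    | [::] => (q', [::], tm_blank M, s :: R)
    | x :: L' => (q', L', x, s :: R)
    end.

Definition tm_run (M : TM) (t : nat) (w : seq bool) : config M :=
  iter t (@tm_step M) (tm_init M w).

Definition cfg_state (M : TM) (c : config M) : tm_state M :=
  let: (q, _, _, _) := c in q.

Definition tm_halts_with (M : TM) (w : seq bool) (t : nat) (b : bool) : Prop :=
  tm_halt M (cfg_state (tm_run M t w)) /\
  tm_accept M (cfg_state (tm_run M t w)) = b.

Definition poly_time_solvable (I : Type) (Valid : I -> Prop)
    (enc : I -> seq bool) (Q : I -> Prop) : Prop :=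
  exists (M : TM) (c k : nat),
    (forall w : seq bool, exists t, t <= c * size w ^ k + c /\
        tm_halt M (cfg_state (tm_run M t w))) /\
    (forall x : I, Valid x -> forall t b,
        tm_halts_with M (enc x) t b -> (b = true <-> Q x)).

Definition graph_input : Type := {n : nat & 'I_n -> 'I_n -> bool}.

Definition problem_rlwcg (r l : nat) : Prop :=
  poly_time_solvable (I := graph_input)
    (fun G => simple_graph (projT2 G))
    (fun G => enc_graph (projT2 G))
    (fun G => rl_well_covered (projT2 G) r l).

Definition labelled_input (r l : nat) : Type :=
  {n : nat & (('I_n -> 'I_n -> bool) * ('I_n -> 'I_(r + l)))%type}.

Definition problem_wcrlg (r l : nat) : Prop :=
  poly_time_solvable (I := labelled_input r l)
    (fun G => simple_graph (projT2 G).1 /\ is_rl_partition (projT2 G).1 r l (projT2 G).2)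
    (fun G => enc_labelled (projT2 G).1 r l (projT2 G).2)
    (fun G => well_covered (projT2 G).1).

(* Main.v *)
Require Import Defs.
From mathcomp Require Import all_boot zify.
Set Implicit Arguments. Unset Strict Implicit. Unset Printing Implicit Defensive.

(* Polynomial time. A "sweeper" is a finite control that repeatedly transforms
   its tape by a left-to-right Mealy pass; a Turing machine simulates one pass
   in linearly many steps by rewinding. The cells carry several bit tracks, a
   number v being stored in thermometer code (the first v bits set). Sweepers
   compose, branch and loop, so the functions computable on tracks contain the
   input and are closed under Boolean operations, arithmetic, quantifiers,
   counting, comprehension and folds over 0, ..., N - 1, where N is the input
   length; all of this takes polynomially many passes.

   Graphs covered by an independent set S and l cliques. An independent set T
   satisfies |T \ S| <= l, and a maximal one is determined by Y = T \ S, namely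
   T = Y + (S \ N(Y)); so comparing all pairs Y1, Y2 with at most l elements
   decides well-coveredness. To recognise well-covered (1,l)-graphs, l <= 2,
   compute a maximal independent set I greedily: we may take S maximal, and then
   |S| = |I|, so S arises from I by exchanging at most l vertices. That V \ S is
   covered by two cliques is bipartiteness of the complement, i.e. the absence
   of closed odd walks.

   Bipartite graphs. Call an edge xy good if every neighbour of x is adjacent to
   every neighbour of y. Then the graph is well-covered iff every non-isolated
   vertex lies on a good edge and the ends of a good edge lie on equally many
   good edges. *)

(** * Machines working in passes *)

Section Sweepers.

Variable S : finType.

(** [sw_out] is consulted only between passes: [None] asks for another pass, [Some b] stops with
    answer [b]. [sw_next] acts at the right end, before the next pass. *)
Record sweeper := Sweeper {
  sw_state : finType;
  sw_start : sw_state;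
  sw_out : sw_state -> option bool;
  sw_delta : sw_state -> S -> sw_state * S;
  sw_next : sw_state -> sw_state }.

Fixpoint pass (Q : Type) (delta : Q -> S -> Q * S) (q : Q) (s : seq S) : Q * seq S :=
  if s is x :: s' then
    let: (q1, y) := delta q x in
    let: (q2, s2) := pass delta q1 s' in (q2, y :: s2)
  else (q, [::]).

Inductive runs (M : sweeper) : nat -> sw_state M -> seq S -> bool -> seq S -> Prop :=
| RunsOut q s b : sw_out q = Some b -> runs 0 q s b s
| RunsStep t q s b s' :
    sw_out q = None ->
    runs t (sw_next (pass (@sw_delta M) q s).1) (pass (@sw_delta M) q s).2 b s' ->
    runs t.+1 q s b s'.

Lemma size_pass (Q : Type) (delta : Q -> S -> Q * S) q s :
  size (pass delta q s).2 = size s.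
Proof.
elim: s q => //= x s IH q; case: (delta q x) => q1 y.
by move: (IH q1); case: (pass _ _ _) => q2 s2 /= ->.
Qed.

Lemma size_runs (M : sweeper) t (q : sw_state M) s b s' :
  runs t q s b s' -> size s' = size s.
Proof. by elim=> //= {}t {}q {}s {}b {}s' _ _ ->; rewrite size_pass. Qed.

(** [R] relates the initial tape, the final tape and the answer; it is a relation so that scratch
    contents may stay unspecified. The time bound holds on every tape, meaningful or not, because
    the Turing machine must halt on every word. The start state must be a running one: loops
    re-enter it. *)
Definition doable (R : seq S -> seq S -> bool -> Prop) : Prop :=
  exists (M : sweeper) (c k : nat), sw_out (sw_start M) = None /\
    forall s, exists t s' b, [/\ t <= c * (size s).+1 ^ k, runs t (sw_start M) s b s' & R s s' b].

Lemma doableW (R R' : seq S -> seq S -> bool -> Prop) :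
  (forall s s' b, size s' = size s -> R s s' b -> R' s s' b) ->
  doable R -> doable R'.
Proof.
move=> RR' [M [c [k [oM HM]]]]; exists M, c, k; split=> // s.
have [t [s' [b [lt_t r_s Rs]]]] := HM s.
by exists t, s', b; split=> //; apply: RR' Rs; apply: size_runs r_s.
Qed.

Lemma doable_pass (Q : finType) (delta : Q -> S -> Q * S) (q0 : Q) (out : Q -> bool) :
  doable (fun s s' b => s' = (pass delta q0 s).2 /\ b = out (pass delta q0 s).1).
Proof.
pose M := @Sweeper (Q + bool)%type (inl q0)
  (fun q => if q is inr b then Some b else None)
  (fun q x => if q is inl q then let: (q', y) := delta q x in (inl q', y) else (q, x))
  (fun q => if q is inl q then inr (out q) else q).
have passE q s : pass (@sw_delta M) (inl q) s =
    (inl (pass delta q s).1, (pass delta q s).2).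
  elim: s q => //= x s IH q; case: (delta q x) => q1 y; rewrite IH.
  by case: (pass delta q1 s).
exists M, 1, 0; split=> // s; exists 1, (pass delta q0 s).2, (out (pass delta q0 s).1).
split=> //; apply: RunsStep => //; rewrite passE /=; exact: RunsOut.
Qed.

Lemma leq_poly2 a b c k d l n :
  a <= c * n.+1 ^ k -> b <= d * n.+1 ^ l -> a + b <= (c + d) * n.+1 ^ (k + l).
Proof.
move=> Ha Hb; rewrite mulnDl; apply: leq_add.
  by apply: leq_trans Ha _; rewrite leq_mul2l leq_pexp2l ?leq_addr ?orbT.
by apply: leq_trans Hb _; rewrite leq_mul2l leq_pexp2l ?leq_addl ?orbT.
Qed.

(** [emb] replaces a halting state of [M] by the start state of the branch that its answer selects,
    so no extra pass is spent. The bounds add up because passes preserve the length of the tape. *)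
Lemma doable_branch R R1 R2 :
  doable R -> doable R1 -> doable R2 ->
  doable (fun s s' b =>
    exists s1 b1, [/\ size s1 = size s, R s s1 b1 &
      if b1 then R1 s1 s' b else R2 s1 s' b]).
Proof.
case=> M [c [k [oM HM]]] [M1 [c1 [k1 [_ HM1]]]] [M2 [c2 [k2 [_ HM2]]]].
pose T := (sw_state M + (sw_state M1 + sw_state M2))%type.
pose emb (q : sw_state M) : T :=
  match sw_out q with
  | Some true => inr (inl (sw_start M1))
  | Some false => inr (inr (sw_start M2))
  | None => inl q
  end.
pose B := @Sweeper T (emb (sw_start M))
  (fun q => match q with
    | inl q => None | inr (inl q) => sw_out q | inr (inr q) => sw_out q end)
  (fun q x => match q with
    | inl q => let: (q', y) := sw_delta q x in (inl q', y)
    | inr (inl q) => let: (q', y) := sw_delta q x in (inr (inl q'), y)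
    | inr (inr q) => let: (q', y) := sw_delta q x in (inr (inr q'), y) end)
  (fun q => match q with
    | inl q => emb (sw_next q)
    | inr (inl q) => inr (inl (sw_next q))
    | inr (inr q) => inr (inr (sw_next q)) end).
have pass0 q s : pass (@sw_delta B) (inl q) s =
    (inl (pass (@sw_delta M) q s).1, (pass (@sw_delta M) q s).2).
  elim: s q => //= x s IH q; case: (sw_delta q x) => q1 y; rewrite IH.
  by case: (pass _ q1 s).
have pass1 q s : pass (@sw_delta B) (inr (inl q)) s =
    (inr (inl (pass (@sw_delta M1) q s).1), (pass (@sw_delta M1) q s).2).
  elim: s q => //= x s IH q; case: (sw_delta q x) => q1 y; rewrite IH.
  by case: (pass _ q1 s).
have pass2 q s : pass (@sw_delta B) (inr (inr q)) s =
    (inr (inr (pass (@sw_delta M2) q s).1), (pass (@sw_delta M2) q s).2).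
  elim: s q => //= x s IH q; case: (sw_delta q x) => q1 y; rewrite IH.
  by case: (pass _ q1 s).
have run1 t q s b s' : @runs M1 t q s b s' -> @runs B t (inr (inl q)) s b s'.
  elim=> [{}q {}s {}b oq|{}t {}q {}s {}b {}s' oq _ IH]; first exact: RunsOut.
  by apply: RunsStep; rewrite // pass1.
have run2 t q s b s' : @runs M2 t q s b s' -> @runs B t (inr (inr q)) s b s'.
  elim=> [{}q {}s {}b oq|{}t {}q {}s {}b {}s' oq _ IH]; first exact: RunsOut.
  by apply: RunsStep; rewrite // pass2.
have run0 t q s b s' t' b' s'' : @runs M t q s b s' ->
    @runs B t' (if b then inr (inl (sw_start M1)) else inr (inr (sw_start M2)))
      s' b' s'' ->
    @runs B (t + t') (emb q) s b' s''.
  elim=> [{}q {}s {}b oq|{}t {}q {}s {}b {}s' oq _ IH] Hr.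
    by rewrite /emb oq; move: Hr; case: b {oq}.
  by rewrite /emb oq addSn; apply: RunsStep; rewrite // pass0 /=; apply: IH.
exists B, (c + (c1 + c2)), (k + (k1 + k2)); split=> [|s]; first by rewrite /= /emb oM.
have [t [s1 [b1 [le_t Hr HR]]]] := HM s.
have sz1 := size_runs Hr.
case: b1 Hr HR => Hr HR.
  have [t' [s' [b [le_t' Hr' HR']]]] := HM1 s1.
  exists (t + t'), s', b; split; last by exists s1, true.
    rewrite sz1 in le_t'; apply: leq_poly2 => //.
    by rewrite -[t']addn0; apply: leq_poly2.
  by apply: (run0 _ _ _ _ _ _ _ _ Hr); apply: run1.
have [t' [s' [b [le_t' Hr' HR']]]] := HM2 s1.
exists (t + t'), s', b; split; last by exists s1, false.
  rewrite sz1 in le_t'; apply: leq_poly2 => //.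
  by rewrite -[t']add0n; apply: leq_poly2.
by apply: (run0 _ _ _ _ _ _ _ _ Hr); apply: run2.
Qed.

Lemma doable_seq R1 R2 :
  doable R1 -> doable R2 ->
  doable (fun s s' b => exists s1 b1, [/\ size s1 = size s, R1 s s1 b1 & R2 s1 s' b]).
Proof.
move=> D1 D2; apply: doableW (doable_branch D1 D2 D2).
by move=> s s' b _ [s1 [b1 [sz H1 H2]]]; exists s1, b1; split=> //; case: b1 H1 H2.
Qed.

Inductive loop_rel (R : seq S -> seq S -> bool -> Prop) : seq S -> seq S -> Prop :=
| LoopEnd s s' : R s s' false -> loop_rel R s s'
| LoopNext s s1 s' : R s s1 true -> loop_rel R s1 s' -> loop_rel R s s'.

(** The measure allows at most [(size s).+1] rounds, which raises the exponent by one. Answer [true]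
    asks for another round. *)
Lemma doable_loop R (mu : seq S -> nat) :
  (forall s, mu s <= size s) -> (forall s s', R s s' true -> mu s' < mu s) ->
  doable R -> doable (fun s s' _ => loop_rel R s s').
Proof.
move=> mu_le mu_dec [M [c [k [oM HM]]]].
pose T := (sw_state M + unit)%type.
pose emb (q : sw_state M) : T :=
  match sw_out q with
  | Some true => inl (sw_start M)
  | Some false => inr tt
  | None => inl q
  end.
pose B := @Sweeper T (inl (sw_start M))
  (fun q => if q is inr _ then Some false else None)
  (fun q x => if q is inl q then let: (q', y) := sw_delta q x in (inl q', y)
              else (q, x))
  (fun q => if q is inl q then emb (sw_next q) else q).
have pass0 q s : pass (@sw_delta B) (inl q) s =
    (inl (pass (@sw_delta M) q s).1, (pass (@sw_delta M) q s).2).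
  elim: s q => //= x s IH q; case: (sw_delta q x) => q1 y; rewrite IH.
  by case: (pass _ q1 s).
have run0 t q s b s' t' b' s'' : @runs M t q s b s' ->
    @runs B t' (if b then inl (sw_start M) else inr tt) s' b' s'' ->
    @runs B (t + t') (emb q) s b' s''.
  elim=> [{}q {}s {}b oq|{}t {}q {}s {}b {}s' oq _ IH] Hr.
    by rewrite /emb oq; move: Hr; case: b {oq}.
  by rewrite /emb oq addSn; apply: RunsStep; rewrite // pass0 /=; apply: IH.
exists B, c, k.+1; split=> // s.
suff: exists t s' b, [/\ t <= (mu s).+1 * (c * (size s).+1 ^ k),
    @runs B t (inl (sw_start M)) s b s' & loop_rel R s s'].
  move=> [t [s' [b [le_t Hr HR]]]]; exists t, s', b; split=> //.
  by rewrite expnS mulnCA; apply: leq_trans le_t _; rewrite leq_mul2r ltnS mu_le orbT.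
move: {2}(mu s).+1 (ltnSn (mu s)) => m; elim: m s => // m IH s le_m.
have [t [s1 [b [le_t Hr HR]]]] := HM s.
have sz1 := size_runs Hr.
have E : inl (sw_start M) = emb (sw_start M) by rewrite /emb oM.
case: b Hr HR => Hr HR; last first.
  exists t, s1, false; split; last exact: LoopEnd.
    by rewrite mulSn; apply: leq_trans le_t (leq_addr _ _).
  by rewrite E -[t]addn0; apply: (run0 _ _ _ _ _ _ _ _ Hr); apply: RunsOut.
have lt1 := mu_dec _ _ HR.
have [t' [s' [b [le_t' Hr' HR']]]] := IH s1 (leq_trans lt1 le_m).
exists (t + t'), s', b; split; last exact: LoopNext HR HR'.
  rewrite mulSn leq_add //; apply: leq_trans le_t' _.
  by rewrite sz1 leq_mul2r lt1 orbT.
by rewrite E; apply: (run0 _ _ _ _ _ _ _ _ Hr).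
Qed.

End Sweepers.

(** * Simulation by Turing machines *)

Section TMofSweeper.

Variables (S : finType) (M : sweeper S) (inj : bool -> S).

Let sym : finType := option S.
(* [Some (q, None)] starts a pass on the leftmost cell, [Some (q, Some true)]
   is inside a pass, [Some (q, Some false)] rewinds; [None] accepts the empty
   input. *)
Let state : finType := option (sw_state M * option bool).

(** The blank [None] differs from every cell, so the head recognises both ends: the right blank
    triggers [sw_next] and the rewinding, the left blank the next pass. *)
Definition sweeper_delta (st : state) (x : sym) : state * sym * bool :=
  match st, x with
  | Some (q, Some false), Some _ => (st, x, false)
  | Some (q, Some false), None => (Some (q, None), x, true)
  | Some (q, _), Some y => let: (q', z) := sw_delta q y in
                           (Some (q', Some true), Some z, true)
  | Some (q, Some true), None => (Some (sw_next q, Some false), x, false)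
  | _, _ => (None, None, true)
  end.

Definition tm_of_sweeper : TM := {|
  tm_state := state; tm_sym := sym; tm_blank := None;
  tm_in := fun b => Some (inj b);
  tm_start := Some (sw_start M, None);
  tm_halt := fun st => match st with
    | Some (q, None) => sw_out q != None | Some _ => false | None => true end;
  tm_accept := fun st => match st with
    | Some (q, None) => sw_out q == Some true | Some _ => false | None => true end;
  tm_delta := sweeper_delta |}.

Let tape st (L X : seq sym) : config tm_of_sweeper :=
  (st, L, head None X, behead X).
Let step : config tm_of_sweeper -> config tm_of_sweeper := @tm_step tm_of_sweeper.

Lemma step_right (st st' : state) L X y :
  tm_halt tm_of_sweeper st = false ->
  sweeper_delta st (head None X) = (st', y, true) ->
  step (tape st L X) = tape st' (y :: L) (behead X).
Proof.
by rewrite /step /tape /= => -> ->; case: X => //= x [].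
Qed.

Lemma step_left (st st' : state) L X y :
  tm_halt tm_of_sweeper st = false ->
  sweeper_delta st (head None X) = (st', y, false) ->
  step (tape st L X) = tape st' (behead L) (head None L :: y :: behead X).
Proof. by rewrite /step /tape /= => -> ->; case: L. Qed.

Lemma iter_sweep q s L Z :
  iter (size s) step (tape (Some (q, Some true)) L (map Some s ++ Z)) =
  tape (Some ((pass (@sw_delta _ M) q s).1, Some true))
       (rev (map Some (pass (@sw_delta _ M) q s).2) ++ L) Z.
Proof.
elim: s q L => // x s IH q L; rewrite [size _]/= iterSr.
case E: (sw_delta q x) => [q1 y].
rewrite (@step_right _ (Some (q1, Some true)) _ _ (Some y)) //; last by rewrite /= E.
rewrite IH [pass _ q (x :: s)]/= E; case: (pass _ q1 s) => q2 s2.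
by rewrite /= rev_cons cat_rcons.
Qed.

Lemma iter_rewind q r L X :
  let L' := map Some r ++ L in
  iter (size r) step (tape (Some (q, Some false)) (behead L') (head None L' :: X)) =
  tape (Some (q, Some false)) (behead L) (head None L :: rev (map Some r) ++ X).
Proof.
elim: r X => // x r IH X; move: (IH (Some x :: X)); rewrite /= => {}IH.
rewrite -iterS iterSr.
rewrite (@step_left _ (Some (q, Some false)) _ _ (Some x)) // IH.
by rewrite rev_cons cat_rcons.
Qed.

(** The numbers of blanks [i] and [j] vary because every visit beyond an end of the word leaves a
    written blank behind. *)
Lemma iter_pass q s i j : 0 < size s -> sw_out q = None ->
  exists i' j', iter ((size s).+1).*2 step
      (tape (Some (q, None)) (nseq i None) (map Some s ++ nseq j None)) =
    tape (Some (sw_next (pass (@sw_delta _ M) q s).1, None)) (nseq i' None)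
      (map Some (pass (@sw_delta _ M) q s).2 ++ nseq j' None).
Proof.
move=> s_gt0 oq; exists i.-1.+1, j.-1.+1.
(* In order of time: [size s] steps to the right, the turn at the right blank, [size s] steps back,
   and one step from the left blank onto the first cell. *)
have -> : ((size s).+1).*2 = (size s).+1 + (1 + size s) by rewrite -addnn add1n.
have E0 : iter (size s) step (tape (Some (q, None)) (nseq i None) (map Some s ++ nseq j None))
  = iter (size s) step (tape (Some (q, Some true)) (nseq i None) (map Some s ++ nseq j None)).
  case: s s_gt0 => // x s _; rewrite [size _]/= !iterSr; congr (iter _ _ _).
  case E: (sw_delta q x) => [q1 y].
  transitivity (tape (Some (q1, Some true)) (Some y :: nseq i None) (map Some s ++ nseq j None)).
    by apply: step_right; rewrite /= ?oq ?E.
  by symmetry; apply: step_right; rewrite /= ?E.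
rewrite iterD iterD E0 iter_sweep.
set r := pass _ q s; set L := rev _ ++ _.
have hn k : head None (nseq k (None : sym)) = None by case: k.
have bn k : behead (nseq k (None : sym)) = nseq k.-1 None by case: k.
rewrite -[iter 1 _ _]/(step _) (@step_left _ (Some (sw_next r.1, Some false)) _ _ None) //; last first.
  by rewrite hn.
have -> : size s = size (rev r.2) by rewrite size_rev size_pass.
rewrite /L -map_rev iterS iter_rewind.
rewrite !hn !bn (@step_right _ (Some (sw_next r.1, None)) _ _ None) //.
by rewrite -map_rev revK.
Qed.

Lemma iter_runs t q s b s' i j : runs t q s b s' -> 0 < size s ->
  exists q' L X, sw_out q' = Some b /\
    iter (t * ((size s).+1).*2) step
      (tape (Some (q, None)) (nseq i None) (map Some s ++ nseq j None)) =
    tape (Some (q', None)) L X.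
Proof.
move=> Hr; elim: Hr i j => [{}q {}s {}b oq|{}t {}q {}s {}b {}s' oq _ IH] i j s_gt0.
  by exists q; do 2!eexists; split; first exact: oq.
have [i' [j' E]] := iter_pass i j s_gt0 oq.
have [|q' [L [X [oq' E']]]] := IH i' j'; first by rewrite size_pass.
exists q', L, X; split=> //.
by rewrite mulSn addnC iterD E -E' size_pass.
Qed.

Lemma tm_init_tape w : 0 < size w ->
  tm_init tm_of_sweeper w =
  tape (Some (sw_start M, None)) (nseq 0 None) (map Some (map inj w) ++ nseq 0 None).
Proof. by case: w => // b w _; rewrite /tape /= cats0 -map_comp. Qed.

Lemma tm_run_halted t t' w :
  tm_halt tm_of_sweeper (cfg_state (tm_run tm_of_sweeper t w)) ->
  t <= t' -> tm_run tm_of_sweeper t' w = tm_run tm_of_sweeper t w.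
Proof.
move=> Ht /subnK <-; rewrite /tm_run iterD -/(tm_run _ t w).
move: (tm_run _ t w) Ht => [[[q L] h] R] Hq.
have E : tm_step (q, L, h, R) = (q, L, h, R) by rewrite /tm_step Hq.
by elim: (t' - t) => //= m ->.
Qed.

End TMofSweeper.

(** The number of passes times the length of a pass is polynomial. The empty word shows a blank at
    once and is accepted after one step; hence the last hypothesis. *)
Lemma poly_time_doable (S : finType) (inj : bool -> S)
    (R : seq S -> seq S -> bool -> Prop) (I : Type) (Valid : I -> Prop)
    (enc : I -> seq bool) (Q : I -> Prop) :
  doable R ->
  (forall x s' b, Valid x -> 0 < size (enc x) -> R (map inj (enc x)) s' b ->
     (b <-> Q x)) ->
  (forall x, Valid x -> size (enc x) = 0 -> Q x) ->
  poly_time_solvable Valid enc Q.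
Proof.
case=> M [c [k [oM HM]]] RQ Q0; pose T := tm_of_sweeper M inj.
have main w : 0 < size w -> exists t b s', [/\ t <= c * (size w).+1 ^ k * (size w).+1.*2,
    tm_halts_with T w t b & R (map inj w) s' b].
  move=> w_gt0; have [t [s' [b [le_t Hr HR]]]] := HM (map inj w).
  rewrite size_map in le_t.
  have [|q [L [X [oq E]]]] := iter_runs inj 0 0 Hr; first by rewrite size_map.
  exists (t * (size w).+1.*2), b, s'; split=> //; first by rewrite leq_mul2r le_t orbT.
  rewrite /tm_halts_with /tm_run tm_init_tape //.
  by rewrite -[in iter _](size_map inj w) E /= oq; split=> //; case: b {Hr HR oq E}.
have halt1 : tm_run T 1 [::] = (None, [:: None], None, [::]) by rewrite /tm_run /= oM.
(* Passes from powers of [n.+1] to powers of [n] through [n.+1 <= 2 * n]. *)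
have poly n : 0 < n -> c * n.+1 ^ k * n.+1.*2 <= c * 2 ^ k.+2 * n ^ k.+1.
  move=> n_gt0; have le2 : n.+1 ^ k.+1 * 2 <= 2 ^ k.+2 * n ^ k.+1.
    rewrite mulnC (expnS 2 k.+1) -mulnA -expnMn leq_mul2l leq_exp2r //.
    by rewrite mul2n -addnn; exact: leq_add n_gt0 (leqnn n).
  by rewrite -muln2 -2!mulnA [X in c * X <= _]mulnA -expnSr leq_mul2l le2 orbT.
(* The summand 1 pays for the single step on the empty word. *)
exists T, (c * 2 ^ k.+2 + 1), k.+1; split=> [w|x Vx t b [Ht Hb]].
  have [w0|w_gt0] := posnP (size w).
    exists 1; rewrite (size0nil w0); split; last by rewrite halt1.
    by rewrite addnC -addnA addnC -addnA.
  have [t [b [s' [le_t [Ht _] _]]]] := main w w_gt0.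
  exists t; split=> //; apply: leq_trans le_t _; apply: leq_trans (poly _ w_gt0) _.
  by rewrite mulnDl -addnA leq_addr.
have [x0|x_gt0] := posnP (size (enc x)).
  split=> [_|_]; first exact: Q0.
  have H1 : tm_halt T (cfg_state (tm_run T 1 (enc x))) by rewrite (size0nil x0) halt1.
  case: t Ht Hb => [|t Ht <-]; last first.
    by rewrite (tm_run_halted H1) // (size0nil x0) halt1.
  by rewrite (size0nil x0) /tm_run /= oM.
have [t0 [b0 [s' [_ [Ht0 Hb0] HR]]]] := main _ x_gt0.
(* A halted configuration never changes, so any two halting times give the same answer. *)
suff -> : b = b0 by exact: RQ HR.
rewrite -Hb -Hb0; case: (leqP t t0) => [le|/ltnW le].
  by rewrite (tm_run_halted Ht le).
by rewrite (tm_run_halted Ht0 le).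
Qed.

(** * Functions computable on tracks *)

Section Tracks.

Variable m : nat.
Definition cell : finType := {ffun 'I_m -> bool}.

Definition get (k : nat) (x : cell) : bool :=
  if insub k is Some i then x i else false.
Definition put (k : nat) (b : bool) (x : cell) : cell :=
  [ffun i : 'I_m => if val i == k then b else x i].
Definition track (k : nat) (s : seq cell) : seq bool := map (get k) s.

Lemma get_put k k' b x : k < m -> get k' (put k b x) = if k' == k then b else get k' x.
Proof.
move=> lt_k; rewrite /get; case: insubP => [i _ <-|]; first by rewrite ffunE.
by have [->|//] := eqVneq k' k; rewrite lt_k.
Qed.

Lemma size_track k s : size (track k s) = size s.
Proof. exact: size_map. Qed.

(* [h] sees the previous bit of the first argument ([q] at the left end). *)
Fixpoint shift_zip (h : bool -> bool -> bool -> bool) (q : bool) (s t : seq bool) :=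
  match s, t with
  | a :: s', b :: t' => h q a b :: shift_zip h a s' t'
  | _, _ => [::]
  end.

Lemma doable_assign k i j h q : k < m ->
  doable (fun (s s' : seq cell) _ =>
    track k s' = shift_zip h q (track i s) (track j s) /\
    forall l, l != k -> track l s' = track l s).
Proof.
move=> lt_k.
pose delta (p : bool) (x : cell) := (get i x, put k (h p (get i x) (get j x)) x).
apply: doableW (doable_pass delta q xpredT) => s s' _ _ [-> _]; split.
  elim: s q => //= x s IH q; move: (IH (get i x)); case: (pass _ _ s) => q2 s2 /= <-.
  by rewrite get_put // eqxx.
move=> l ne_lk; elim: s q => //= x s IH q; move: (IH (get i x)).
by case: (pass _ _ s) => q2 s2 /= ->; rewrite get_put // (negPf ne_lk).
Qed.

Lemma doable_test (k : nat) (p : pred bool) :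
  doable (fun (s s' : seq cell) b => s' = s /\ b = has p (track k s)).
Proof.
pose delta (q : bool) (x : cell) := (q || p (get k x), x).
apply: doableW (doable_pass delta false id) => s s' b _ [-> ->]; split.
  by elim: s false => //= x s IH q; move: (IH (q || p (get k x))); case: (pass _ _ s) => ? ? /= ->.
rewrite -[has _ _]orFb; elim: s false => //= [[]//|x s IH q].
by rewrite orbA -IH; case: (pass _ _ s).
Qed.

(** A last idle pass overrides the answer; this tells a surrounding loop whether to go on. *)
Lemma doable_exit (R : seq cell -> seq cell -> bool -> Prop) (b0 : bool) :
  doable R -> doable (fun s s' b => b = b0 /\ exists b', R s s' b').
Proof.
move=> D; have := doable_seq D (doable_pass (fun (_ : unit) (x : cell) => (tt, x)) tt (fun=> b0)).
apply: doableW => s s' b _ [s1 [b1 [_ HR [-> ->]]]]; split=> //; exists b1.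
suff -> : (pass (fun (_ : unit) (x : cell) => (tt, x)) tt s1).2 = s1 by [].
by elim: (s1) => //= x s1' {2}<-; case: (pass _ _ _).
Qed.

End Tracks.

Lemma shift_zip_mkseq h q (F G : nat -> bool) n :
  shift_zip h q (mkseq F n) (mkseq G n) =
  mkseq (fun i => h (if i is j.+1 then F j else q) (F i) (G i)) n.
Proof.
rewrite /mkseq; elim: n F G q => // n IH F G q /=; congr (_ :: _).
rewrite -[1]addn0 !iotaDl -!map_comp IH.
by apply: eq_map => -[|i].
Qed.

(** * Contexts and computable functions *)

(** [cty] holds the values of all free variables, each entry of [cvars] reads one of them as a bit
    sequence of length [clen], and [cok] records the assumptions under which results must be
    right. *)
Record ctx := Ctx {
  cty : Type;
  clen : cty -> nat;
  cok : cty -> Prop;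
  cvars : seq (cty -> nat -> bool) }.

Definition matches m (c : ctx) (rho : seq nat) (g : cty c) (s : seq (cell m)) : Prop :=
  [/\ cok g, 0 < size s, size s = clen g &
      map (fun i => track i s) rho = map (fun v : cty c -> nat -> bool => mkseq (v g) (clen g)) (cvars c)].

(** Tracks form a stack: those below [d] are preserved, the result goes to track [d], and [w] tracks
    from [d] on are work space. Termination and preservation hold on every tape; only the result
    presupposes that the tracks [rho] hold the variables. *)
Definition computable (c : ctx) (F : cty c -> nat -> bool) : Prop :=
  exists w, forall m d rho, all (fun i => i < d) rho -> d + w <= m ->
    size rho = size (cvars c) ->
    doable (fun (s s' : seq (cell m)) (_ : bool) =>
      (forall i, i < d -> track i s' = track i s) /\
      forall g, matches rho g s -> track d s' = mkseq (F g) (clen g)).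

Lemma matches_stable m c rho g d (s s' : seq (cell m)) :
  all (fun i => i < d) rho -> size s' = size s ->
  (forall i, i < d -> track i s' = track i s) ->
  @matches m c rho g s -> matches rho g s'.
Proof.
move=> lt_rho sz E [okg sz_gt0 szg Erho]; split; rewrite ?sz //.
rewrite -Erho; apply/eq_in_map => i /(allP lt_rho); exact: E.
Qed.

Lemma allW_lt d d' rho : d <= d' -> all (fun i => i < d) rho -> all (fun i => i < d') rho.
Proof. by move=> le; apply: sub_all => i /leq_trans; apply. Qed.

Section Closure.

Variable c : ctx.
Implicit Types F G : cty c -> nat -> bool.

Lemma computable_ext F G :
  (forall g i, cok g -> i < clen g -> F g i = G g i) -> computable F -> computable G.
Proof.
move=> FG [w HF]; exists w => m d rho lt_rho le_m sz.
apply: doableW (HF m d rho lt_rho le_m sz) => s s' _ szs [H1 H2]; split=> // g Hg.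
rewrite (H2 g Hg); apply/eq_in_map => i; rewrite mem_iota => /andP[_ lt_i].
by apply: FG => //; case: Hg.
Qed.

(** Besides pointwise operations this gives access to the previous bit of [F], with [q] before the
    first one. The increment and the unit vectors below rest on this shift. *)
Lemma computable_op h q F G : computable F -> computable G ->
  computable (fun g i => h (if i is j.+1 then F g j else q) (F g i) (G g i)).
Proof.
move=> [w HF] [w' HG]; exists (w + w').+1 => m d rho lt_rho le_m sz.
have le1 : d + w <= m.
  by apply: leq_trans le_m; rewrite leq_add2l leqW // leq_addr.
have le2 : d.+1 + w' <= m.
  by apply: leq_trans le_m; rewrite addnS addSn ltnS leq_add2l leq_addl.
have lt_d : d < m by apply: leq_trans le2; rewrite leq_addr.
have := doable_seq (HF m d rho lt_rho le1 sz)
  (doable_seq (HG m d.+1 rho (allW_lt (leqnSn d) lt_rho) le2 sz)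
    (@doable_assign m d d d.+1 h q lt_d)).
apply: doableW => s s' b szs [s1 [_ [sz1 [A1 B1] [s2 [_ [_ [A2 B2] [C2 D2]]]]]]].
split=> [i lt_i|g Hg].
  by rewrite D2 ?neq_ltn ?lt_i // A2 ?A1 // ltnW.
rewrite C2 A2 // (B1 g Hg) (B2 g) ?shift_zip_mkseq //.
exact: (matches_stable lt_rho sz1 A1 Hg).
Qed.

Lemma computable_var k : k < size (cvars c) ->
  computable (nth (fun _ _ => false) (cvars c) k).
Proof.
move=> lt_k; exists 1 => m d rho lt_rho le_m sz.
have lt_d : d < m by rewrite addn1 in le_m.
apply: doableW (@doable_assign m d (nth 0 rho k) (nth 0 rho k) (fun _ _ b => b) false lt_d).
move=> s s' _ szs [C D]; split=> [i lt_i|g [_ _ szg E]]; first by rewrite D ?neq_ltn ?lt_i.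
have -> : track d s' = track (nth 0 rho k) s.
  by rewrite C; elim: (track _ _) false => //= x t IH q; rewrite IH.
have := congr1 (fun r => nth [::] r k) E.
by rewrite (nth_map 0) ?sz // (nth_map (fun _ _ => false)).
Qed.

Lemma computable_const (b : bool) : computable (c := c) (fun _ _ => b).
Proof.
exists 1 => m d rho lt_rho le_m sz.
have lt_d : d < m by rewrite addn1 in le_m.
apply: doableW (@doable_assign m d d d (fun _ _ _ => b) b lt_d).
move=> s s' _ szs [C D]; split=> [i lt_i|g [_ _ szg E]]; first by rewrite D ?neq_ltn ?lt_i.
rewrite C /mkseq -szg -(size_track d s).
by elim: (track d s) {2}b 0 => //= a t IH q i; rewrite (IH a i.+1).
Qed.

Lemma computable_has F :
  computable F -> computable (fun g _ => has (F g) (iota 0 (clen g))).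
Proof.
move=> [w HF]; have [w1 H1] := computable_const true; have [w0 H0] := computable_const false.
exists (w + (w1 + w0)) => m d rho lt_rho le_m sz.
have le : d + w <= m by apply: leq_trans le_m; rewrite leq_add2l leq_addr.
have le1 : d + w1 <= m.
  by apply: leq_trans le_m; rewrite leq_add2l addnCA leq_addr.
have le0 : d + w0 <= m by apply: leq_trans le_m; rewrite leq_add2l addnA leq_addl.
have := doable_seq (HF m d rho lt_rho le sz)
  (doable_branch (@doable_test m d id) (H1 m d rho lt_rho le1 sz) (H0 m d rho lt_rho le0 sz)).
apply: doableW => s s' b szs [s1 [_ [sz1 [A1 B1] [s2 [b2 [_ [-> Eb2] H]]]]]].
split=> [i lt_i|g Hg]; first by case: b2 Eb2 H => _ [H _]; rewrite H ?A1.
have -> : has (F g) (iota 0 (clen g)) = b2 by rewrite Eb2 (B1 g Hg) has_map.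
by case: b2 Eb2 H => _ [_]; apply; apply: (matches_stable lt_rho sz1 A1 Hg).
Qed.

Definition restrict (B : cty c -> bool) : ctx :=
  @Ctx (cty c) (@clen c) (fun g => cok g /\ B g) (cvars c).

(** [F] is run in any case; where [B] fails it may leave garbage in its track, which the conjunction
    masks. So [F] need only be correct under the assumption [B]. *)
Lemma computable_guard (B : cty c -> bool) F :
  computable (fun g _ => B g) -> computable (c := restrict B) F ->
  computable (fun g i => B g && F g i).
Proof.
move=> [w HB] [w' HF]; exists (w + w').+1 => m d rho lt_rho le_m sz.
have le1 : d + w <= m.
  by apply: leq_trans le_m; rewrite leq_add2l leqW // leq_addr.
have le2 : d.+1 + w' <= m.
  by apply: leq_trans le_m; rewrite addnS addSn ltnS leq_add2l leq_addl.
have lt_d : d < m by apply: leq_trans le2; rewrite leq_addr.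
have := doable_seq (HB m d rho lt_rho le1 sz)
  (doable_seq (HF m d.+1 rho (allW_lt (leqnSn d) lt_rho) le2 sz)
    (@doable_assign m d d d.+1 (fun _ => andb) true lt_d)).
apply: doableW => s s' b szs [s1 [_ [sz1 [A1 B1] [s2 [_ [sz2 [A2 B2] [C2 D2]]]]]]].
split=> [i lt_i|g Hg].
  by rewrite D2 ?neq_ltn ?lt_i // A2 ?A1 // ltnW.
rewrite C2 A2 // (B1 g Hg); case EB: (B g); last first.
  have [_ _ szg _] := Hg; rewrite /mkseq -szg -sz1 -sz2 -(size_track d.+1 s2).
  by elim: (track d.+1 s2) true 0 => //= a t IH q i; rewrite (IH false i.+1).
have [okg s1_gt0 szg Eg] := matches_stable lt_rho sz1 A1 Hg.
by rewrite (B2 g) ?shift_zip_mkseq.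
Qed.

End Closure.

(** * Context extension and iteration *)

Definition ext (c : ctx) (X : Type) (den : X -> nat -> bool) (R : cty c -> X -> Prop) : ctx :=
  @Ctx (cty c * X) (fun p => clen p.1) (fun p => cok p.1 /\ R p.1 p.2)
    ((fun p => den p.2) :: [seq (fun p => v p.1) | v <- cvars c]).

Lemma matches_ext m c X den R rho d g (x : X) (s : seq (cell m)) :
  R g x -> track d s = mkseq (den x) (clen g) -> @matches m c rho g s ->
  @matches m (@ext c X den R) (d :: rho) (g, x) s.
Proof.
move=> Rgx Ed [okg s_gt0 szg E]; split=> //=; rewrite Ed; congr (_ :: _).
by rewrite E -map_comp.
Qed.

Definition thermo (v i : nat) : bool := i < v.

Definition iter_ctx (c : ctx) (X : Type) (den : X -> nat -> bool) : ctx :=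
  @ext (@ext c nat thermo (fun g t => t < clen g)) X den (fun _ _ => True).

(** Track [d] holds the accumulator and track [d.+1] the counter. A round computes the new
    accumulator in track [d.+2], copies it down and increments the counter; the loop ends when the
    counter fills its track. The type [X] is arbitrary: only the bits [den x] are stored. *)
Lemma computable_iter c X den (x0 : cty c -> X) (step : cty c -> nat -> X -> X) :
  computable (fun g => den (x0 g)) ->
  computable (c := iter_ctx c den) (fun p => den (step p.1.1 p.1.2 p.2)) ->
  computable (fun g => den (foldl (fun x t => step g t x) (x0 g) (iota 0 (clen g)))).
Proof.
move=> [w0 H0] [w H1]; exists (w0 + w).+3 => m d rho lt_rho le_m sz.
have le0 : d + w0 <= m.
  by apply: leq_trans le_m; rewrite leq_add2l !leqW // leq_addr.
have le1 : d.+2 + w <= m.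
  by apply: leq_trans le_m; rewrite !addnS !addSn leqW // !ltnS leq_add2l leq_addl.
have lt_d1 : d.+1 < m by apply: leq_trans le_m; rewrite !addnS !ltnS leqW ?leq_addr.
have lt_d : d < m := ltnW lt_d1.
pose rho' := [:: d, d.+1 & rho].
have lt_rho' : all (fun i => i < d.+2) rho'.
  by rewrite /= ltnSn leqnSn; apply: allW_lt lt_rho; rewrite !leqW.
have sz' : size rho' = size (cvars (iter_ctx c den)) by rewrite /= !size_map sz.
(* [bump] is the successor in thermometer code, and on every tape, meaningful
   or not, it lowers the number of unset bits: so the loop always stops. *)
pose bump := @doable_assign m d.+1 d.+1 d.+1 (fun p a _ => a || p) true lt_d1.
pose copy := @doable_assign m d d.+2 d.+2 (fun _ _ b => b) false lt_d.
have body := doable_branch (@doable_test m d.+1 negb)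
  (doable_exit true (doable_seq (H1 m d.+2 rho' lt_rho' le1 sz') (doable_seq copy bump)))
  (doable_exit false (@doable_test m d id)).
have zip_copy s t q : size s = size t -> shift_zip (fun _ _ b => b) q s t = t.
  by elim: s t q => [|x s IH] [|y t] q //= [/IH->].
(* The contract of one round: the outer tracks and the progress of the counter are guaranteed on all
   tapes, the new accumulator only on tapes that represent a state of the loop. *)
pose R1 (s s' : seq (cell m)) (b : bool) :=
  [/\ size s' = size s, forall i, i < d -> track i s' = track i s,
    b = has negb (track d.+1 s) &
    if b then track d.+1 s' = shift_zip (fun p a _ => a || p) true (track d.+1 s) (track d.+1 s)
      /\ (forall g x t, t < clen g -> track d s = mkseq (den x) (clen g) ->
           track d.+1 s = mkseq (thermo t) (clen g) ->
           matches rho g s -> track d s' = mkseq (den (step g t x)) (clen g))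
    else s' = s].
have {}body : doable R1.
  apply: doableW body => s s' b szs [s1 [b1 [_ [-> Eb1] H]]]; rewrite /R1 -Eb1.
  case: b1 Eb1 H => Eb1; last by move=> [-> [b' [-> _]]].
  move=> [-> [b' [s2 [_ [sz2 [A2 B2] [s3 [_ [sz3 [C3 D3] [C4 D4]]]]]]]]].
  split=> // [i lt_i|].
    by rewrite D4 ?D3 ?A2 // ?neq_ltn ?lt_i ?ltnS ?(ltnW lt_i) ?leqW // ltnW.
  split=> [|g x t lt_t Ed Ed1 Hg].
    by rewrite C4 D3 ?neq_ltn ?ltnSn ?orbT // A2.
  rewrite D4 ?neq_ltn ?ltnSn // C3 zip_copy ?size_track //.
  by apply: (B2 (g, t, x)); apply: matches_ext => //; apply: matches_ext.
have loop : doable (fun s s' (_ : bool) => loop_rel R1 s s').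
  apply: (@doable_loop _ R1 (fun s => count negb (track d.+1 s))) body => [s|s s'].
    by rewrite -(size_track d.+1 s) count_size.
  move=> [_ _ /esym + [E _]]; rewrite E.
  have aux t : count negb (shift_zip (fun p a _ => a || p) false t t) <= count negb t.
    have: forall q, count negb (shift_zip (fun p a _ => a || p) q t t) <= count negb t.
      by elim: t => //= a t IH q; apply: leq_add; [case: a; case: q | exact: IH].
    by apply.
  elim: (track _ s) => //= a t IH; case: a => /= [/IH|_]; first by rewrite !add0n.
  by rewrite add0n add1n ltnS aux.
have pres i t t' : i < d -> loop_rel R1 t t' -> track i t' = track i t.
  move=> lt_i; elim=> [{}t {}t' [_ H _ _]|{}t t1 {}t' [_ H _ _] _ ->]; exact: H.
have has_thermo k n : has negb (mkseq (thermo k) n) = (k < n).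
  rewrite /mkseq has_map; apply/hasP/idP => [[i]|lt_k].
    by rewrite mem_iota add0n /= /thermo -leqNgt => lt_i /leq_ltn_trans; apply.
  by exists k; rewrite ?mem_iota //= /thermo ltnn.
(* The loop invariant: from counter [k] and accumulator [x], the remaining rounds fold over [k],
   ..., [clen g - 1]. *)
have result g x k t t' : loop_rel R1 t t' -> matches rho g t -> k <= clen g ->
    track d t = mkseq (den x) (clen g) -> track d.+1 t = mkseq (thermo k) (clen g) ->
    track d t' = mkseq (den (foldl (fun x t => step g t x) x (iota k (clen g - k)))) (clen g).
  move=> L; elim: L x k => [{}t {}t' [_ _ E ->]|{}t t1 {}t' [sz1 pr1 E [Eb Ed']] _ IH] x k Hg le_k Ed Ed1;
    rewrite Ed1 has_thermo in E.
    by have/eqP -> : clen g - k == 0 by rewrite subn_eq0 leqNgt -E.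
  rewrite -(subnSK (esym E)) /=; apply: IH => //.
  - exact: (matches_stable lt_rho sz1 pr1 Hg).
  - exact: Ed' Ed Ed1 Hg.
  - rewrite Eb Ed1 shift_zip_mkseq; apply/eq_map => i; rewrite /thermo ltnS.
    by case: i => [|i]; [rewrite orbT | apply: orb_idl => /ltnW].
pose zero := @doable_assign m d.+1 d.+1 d.+1 (fun _ _ _ => false) false lt_d1.
have := doable_seq (H0 m d rho lt_rho le0 sz) (doable_seq zero loop).
apply: doableW => s s' b szs [s1 [_ [sz1 [A1 B1] [s2 [_ [sz2 [C2 D2] L]]]]]].
split=> [i lt_i|g Hg]; first by rewrite (pres i _ _ lt_i L) D2 ?A1 // neq_ltn ltnS (ltnW lt_i).
have Hg2 : matches rho g s2.
  apply: (matches_stable lt_rho _ _ Hg); first by rewrite sz2 sz1.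
  by move=> i lt_i; rewrite D2 ?A1 // neq_ltn ltnS (ltnW lt_i).
have Ed : track d s2 = mkseq (den (x0 g)) (clen g) by rewrite D2 ?(B1 g Hg) // neq_ltn ltnSn.
have Ed1 : track d.+1 s2 = mkseq (thermo 0) (clen g).
  have [_ _ szg _] := Hg; rewrite C2 /mkseq -szg -sz1 -(size_track d.+1 s1).
  by elim: (track d.+1 s1) {2}false {2}0 => //= a t IH q i; rewrite (IH a i.+1).
by rewrite -[X in iota 0 X]subn0; apply: (result g (x0 g) 0 s2 s').
Qed.

(** * Logic and arithmetic on tracks *)

(** Weakening: whatever is computable in [c] stays so in [c'], where more variables or assumptions
    may be present. *)
Definition cmorph (c' c : ctx) (h : cty c' -> cty c) : Prop :=
  [/\ forall g, cok g -> cok (h g), forall g, clen (h g) = clen g &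
      forall F, computable F -> computable (fun g => F (h g))].

Lemma cmorph_drop c' c (h : cty c' -> cty c) V :
  (forall g, cok g -> cok (h g)) -> (forall g, clen (h g) = clen g) ->
  cvars c' = V ++ [seq (fun p => v (h p)) | v <- cvars c] -> cmorph h.
Proof.
move=> hok hlen EV; split=> // F [w HF]; exists w => m d rho lt_rho le_m sz.
have lt' : all (fun i => i < d) (drop (size V) rho).
  by apply/allP=> i /mem_drop; apply: (allP lt_rho).
have sz' : size (drop (size V) rho) = size (cvars c).
  by rewrite size_drop sz EV size_cat size_map addKn.
apply: doableW (HF m d _ lt' le_m sz') => s s' _ _ [A B]; split=> // g [okg s_gt0 szg E].
rewrite -hlen; apply: B; split; rewrite ?hlen //; first exact: hok.
by rewrite map_drop E EV map_cat drop_size_cat ?size_map // -map_comp.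
Qed.

Lemma cmorph_comp c2 c1 c0 (h : cty c1 -> cty c0) (k : cty c2 -> cty c1) :
  cmorph h -> cmorph k -> cmorph (fun g => h (k g)).
Proof.
move=> [h1 h2 h3] [k1 k2 k3]; split=> [g /k1/h1|g|F /h3/k3] //.
by rewrite h2 k2.
Qed.

Lemma cmorph_id c : cmorph (fun g : cty c => g).
Proof. by split. Qed.

Lemma cmorph_fst c X den R : cmorph (c' := @ext c X den R) fst.
Proof.
by apply: (@cmorph_drop (ext den R) c fst [:: fun p => den p.2]) => // -[g x] [].
Qed.

Definition BC c (P : cty c -> bool) := computable (fun g _ => P g).
(** A track has [clen g] cells, so a value above [clen g] is seen only as a full track. This is why
    comparisons below require bounds. *)
Definition NC c (f : cty c -> nat) := computable (fun g => thermo (f g)).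

Definition bound c (b : cty c -> nat) : ctx := @ext c nat thermo (fun g t => t < b g).

Lemma NC_snd c b : NC (c := @bound c b) (fun p => p.2).
Proof. exact: (@computable_var (bound b) 0). Qed.

Lemma computable_snd c X den R : computable (c := @ext c X den R) (fun p => den p.2).
Proof. exact: (@computable_var (ext den R) 0). Qed.

Lemma computable_wk c X den R F : computable F -> computable (c := @ext c X den R) (fun p => F p.1).
Proof. by have [_ _] := cmorph_fst den R; apply. Qed.

Section Macros.

Variable c : ctx.
Implicit Types (P : cty c -> bool) (f : cty c -> nat) (A : cty c -> nat -> bool).

Lemma computable_not A : computable A -> computable (fun g i => ~~ A g i).
Proof. by move=> HA; exact: (computable_op (fun _ a _ => ~~ a) true HA HA). Qed.

Lemma computable_and A A' :
  computable A -> computable A' -> computable (fun g i => A g i && A' g i).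
Proof. by move=> H H'; exact: (computable_op (fun _ => andb) true H H'). Qed.

Lemma computable_or A A' :
  computable A -> computable A' -> computable (fun g i => A g i || A' g i).
Proof. by move=> H H'; exact: (computable_op (fun _ => orb) true H H'). Qed.

Lemma BC_not P : BC P -> BC (fun g => ~~ P g). Proof. exact: computable_not. Qed.
Lemma BC_and P P' : BC P -> BC P' -> BC (fun g => P g && P' g).
Proof. exact: computable_and. Qed.
Lemma BC_or P P' : BC P -> BC P' -> BC (fun g => P g || P' g).
Proof. exact: computable_or. Qed.
Lemma BC_imp P P' : BC P -> BC P' -> BC (fun g => P g ==> P' g).
Proof. by move=> H H'; exact: (computable_op (fun _ => implb) true H H'). Qed.
Lemma BC_eqb P P' : BC P -> BC P' -> BC (fun g => P g == P' g).
Proof. by move=> H H'; exact: (computable_op (fun _ => eq_op) true H H'). Qed.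

Lemma BC_ext P P' : (forall g, cok g -> P g = P' g) -> BC P -> BC P'.
Proof. by move=> E; apply: computable_ext => g i okg _; rewrite E. Qed.

Lemma NC_ext f f' : (forall g, cok g -> f g = f' g) -> NC f -> NC f'.
Proof. by move=> E; apply: computable_ext => g i okg _; rewrite E. Qed.

Lemma NC_incr f P : NC f -> BC P -> NC (fun g => f g + P g).
Proof.
move=> Hf HP.
(* The successor of a thermometer is its shift by one cell with a set bit fed in on the left. *)
apply: computable_ext (computable_op (fun p a b => if b then p else a) true Hf HP).
by move=> g i _ _; rewrite /thermo; case: (P g); rewrite ?addn0 // addn1; case: i.
Qed.

Lemma NC_const n : NC (fun _ : cty c => n).
Proof.
elim: n => [|n IH]; first exact: (computable_const c false).
by apply: NC_ext (NC_incr IH (computable_const c true)) => g _; rewrite addn1.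
Qed.

(** The unit vector at [f g] marks the cell where the thermometer falls: previous bit set, current
    bit unset. The bit before the first cell counts as set, which covers the value 0. *)
Lemma computable_eq f : NC f -> computable (fun g i => i == f g).
Proof.
move=> Hf; apply: computable_ext (computable_op (fun p a _ => p && ~~ a) true Hf Hf).
move=> g [|i] _ _ /=; rewrite /thermo -leqNgt; first by rewrite leqn0 eq_sym.
by rewrite eqn_leq andbC.
Qed.

Lemma BC_mem A f : (forall g, cok g -> f g < clen g) -> computable A -> NC f ->
  BC (fun g => A g (f g)).
Proof.
move=> lt_f HA Hf.
apply: computable_ext (computable_has (computable_and HA (computable_eq Hf))).
move=> g _ okg _; apply/hasP/idP => [[j _ /andP[Aj /eqP<-]]//|Af].
by exists (f g); rewrite ?mem_iota ?lt_f // Af eqxx.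
Qed.

(** The inequality means that some cell is unset for [f] and set for [f']; the bound on [f'] keeps
    such a cell on the tape. *)
Lemma BC_lt f f' : (forall g, cok g -> f' g <= clen g) -> NC f -> NC f' ->
  BC (fun g => f g < f' g).
Proof.
move=> le_f' Hf Hf'.
apply: computable_ext (computable_has (computable_and (computable_not Hf) Hf')).
move=> g _ okg _; rewrite /thermo; apply/hasP/idP => [[j _ /andP[]]|lt_f].
  by rewrite -leqNgt => /leq_ltn_trans; apply.
by exists (f g); rewrite ?ltnn ?lt_f // mem_iota (leq_trans lt_f) ?le_f'.
Qed.

Lemma BC_eq f f' : (forall g, cok g -> f g <= clen g) ->
  (forall g, cok g -> f' g <= clen g) -> NC f -> NC f' -> BC (fun g => f g == f' g).
Proof.
move=> le_f le_f' Hf Hf'.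
apply: BC_ext (BC_not (BC_or (BC_lt le_f' Hf Hf') (BC_lt le_f Hf' Hf))) => g _.
by case: ltngtP.
Qed.

Lemma computable_ite (P : cty c -> bool) (F G : cty c -> nat -> bool) :
  BC P -> computable F -> computable G -> computable (fun g i => if P g then F g i else G g i).
Proof.
move=> HP HF HG.
apply: computable_ext (computable_or (computable_and HP HF) (computable_and (BC_not HP) HG)).
by move=> g i _ _; case: (P g); rewrite ?orbF.
Qed.

End Macros.

(** Idle rounds let a loop over the whole tape stand for a loop of length [b]. *)
Lemma foldl_guard (X : Type) (step : X -> nat -> X) x b N : b <= N ->
  (forall x t, b <= t -> step x t = x) ->
  foldl step x (iota 0 N) = foldl step x (iota 0 b).
Proof.
move=> le_b st; rewrite -(subnKC le_b) iotaD foldl_cat add0n.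
have idle k b' y : b <= b' -> foldl step y (iota b' k) = y.
  by elim: k b' y => //= k IH b' y le_b'; rewrite st // IH // leqW.
exact: idle.
Qed.

(** * Bounded quantifiers, counting and comprehension *)

Section Quantifiers.

Variables (c : ctx) (b : cty c -> nat).
Hypotheses (Hb : NC b) (le_b : forall g, cok g -> b g <= clen g).

Lemma BC_guard X den (P : cty c -> nat -> bool) :
  BC (c := bound b) (fun p => P p.1 p.2) ->
  BC (c := @iter_ctx c X den) (fun p => (p.1.2 < b p.1.1) && P p.1.1 p.1.2).
Proof.
move=> HP; apply: computable_guard.
  apply: BC_lt => [g [[okg _] _]||]; first exact: le_b.
    exact: computable_wk (NC_snd _).
  exact: (computable_wk _ _ (computable_wk _ _ Hb)).
pose c' := restrict (c := iter_ctx c den) (fun p => p.1.2 < b p.1.1).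
have [_ _ mor] : cmorph (c := bound b) (c' := c') (fun p => p.1).
  by apply: (@cmorph_drop c' (bound b) _ [:: fun p => den p.2]) => // -[[g t] x] /= [[[]]].
exact: mor HP.
Qed.

Lemma BC_has (P : cty c -> nat -> bool) :
  BC (c := bound b) (fun p => P p.1 p.2) -> BC (fun g => has (P g) (iota 0 (b g))).
Proof.
move=> HP; pose den (x : bool) (_ : nat) := x.
have := @computable_iter c bool den (fun=> false) (fun g t x => x || ((t < b g) && P g t)).
move/(_ (computable_const _ _) (computable_or (computable_snd _ _) (BC_guard den HP))).
apply: computable_ext => g i okg _; rewrite /den (@foldl_guard _ _ _ (b g)) ?le_b //.
  have: forall t, t \in iota 0 (b g) -> t < b g by move=> t; rewrite mem_iota.
  rewrite -[RHS]orFb; elim: (iota 0 _) false => [x|t s IH x lt] /=; first by rewrite orbF.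
  by rewrite IH ?lt ?mem_head ?orbA // => t' t's; rewrite lt // in_cons t's orbT.
by move=> x t; rewrite ltnNge => ->; rewrite orbF.
Qed.

Lemma BC_all (P : cty c -> nat -> bool) :
  BC (c := bound b) (fun p => P p.1 p.2) -> BC (fun g => all (P g) (iota 0 (b g))).
Proof.
move=> HP; apply: BC_ext (BC_not (BC_has (P := fun g t => ~~ P g t) (BC_not HP))) => g _.
by rewrite -all_predC; apply: eq_all => t /=; rewrite negbK.
Qed.

Lemma NC_count (P : cty c -> nat -> bool) :
  BC (c := bound b) (fun p => P p.1 p.2) -> NC (fun g => count (P g) (iota 0 (b g))).
Proof.
move=> HP.
have := @computable_iter c nat thermo (fun=> 0) (fun g t x => x + ((t < b g) && P g t)).
move/(_ (NC_const _ _) (NC_incr (computable_snd _ _) (BC_guard thermo HP))).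
apply: computable_ext => g i okg _; rewrite (@foldl_guard _ _ _ (b g)) ?le_b //.
  suff fold s x : (forall t, t \in s -> t < b g) ->
      foldl (fun x t => x + ((t < b g) && P g t)) x s = x + count (P g) s.
    by rewrite fold // => t; rewrite mem_iota.
  elim: s x => [x _|t s IH x lt] /=; first by rewrite addn0.
  by rewrite IH ?lt ?mem_head ?addnA // => t' t's; rewrite lt // in_cons t's orbT.
by move=> x t; rewrite ltnNge => ->; rewrite addn0.
Qed.

(** The accumulator is the set collected so far, and round [t] adds [t] if [P] holds: a predicate
    with a free variable becomes a track. *)
Lemma computable_compr (P : cty c -> nat -> bool) :
  BC (c := bound b) (fun p => P p.1 p.2) -> computable (fun g i => (i < b g) && P g i).
Proof.
move=> HP; pose den (A : nat -> bool) := A.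
have := @computable_iter c (nat -> bool) den (fun _ _ => false)
  (fun g t A i => A i || (((t < b g) && P g t) && (i == t))).
move/(_ (computable_const _ _) (computable_or (computable_snd _ _) (computable_and
  (BC_guard den HP) (computable_eq (computable_wk _ _ (NC_snd _)))))).
apply: computable_ext => g i okg lt_i; rewrite /den.
suff fold s A : foldl (fun A t i => A i || (((t < b g) && P g t) && (i == t))) A s i =
    A i || ((i \in s) && ((i < b g) && P g i)).
  by rewrite fold mem_iota lt_i.
elim: s A => [A|t s IH A] /=; first by rewrite orbF.
rewrite IH in_cons -orbA; congr (_ || _).
by have [->|ne] := eqVneq i t; rewrite ?andbT ?andbF //=; case: (_ && _); rewrite ?andbF.
Qed.

End Quantifiers.

(** One increment for each position below [f'] adds [minn (f' g) (clen g)]; on a track of length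
    [clen g] this looks the same as adding [f' g]. *)
Lemma NC_add c (f f' : cty c -> nat) : NC f -> NC f' -> NC (fun g => f g + f' g).
Proof.
move=> Hf Hf'; have := @computable_iter c nat thermo f (fun g t x => x + (t < f' g)).
move/(_ Hf) => H; apply: computable_ext (H _); last first.
  apply: NC_incr; first exact: computable_snd.
  apply: (@BC_mem (iter_ctx c thermo) (fun p => thermo (f' p.1.1)) (fun p => p.1.2)).
  - by move=> p [[]].
  - exact: (computable_wk _ _ (computable_wk _ _ Hf')).
  - exact: computable_wk (NC_snd _).
move=> g i okg lt_i; have -> : foldl (fun x t => x + (t < f' g)) (f g) (iota 0 (clen g)) =
    f g + minn (f' g) (clen g).
  elim: (clen g) => [|n IH]; first by rewrite minn0 addn0.
  rewrite -addn1 iotaD foldl_cat IH /= add0n -addnA; congr (_ + _).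
  by case: (ltnP n (f' g)) => /= ?; lia.
by rewrite /thermo; apply/idP/idP => ?; lia.
Qed.

Lemma NC_mul c (f f' : cty c -> nat) : (forall g, cok g -> f g <= clen g) ->
  NC f -> NC f' -> NC (fun g => f g * f' g).
Proof.
move=> le_f Hf Hf'.
have := @computable_iter c nat thermo (fun=> 0)
   (fun g t x => if t < f g then x + f' g else x).
move/(_ (NC_const _ _)) => H; apply: computable_ext (H _); last first.
  pose c' := iter_ctx c thermo.
  have H1 : BC (c := c') (fun p => p.1.2 < f p.1.1).
    apply: BC_lt => [p [[okg _] _]||]; first exact: le_f.
      exact: computable_wk (NC_snd _).
    exact: (computable_wk _ _ (computable_wk _ _ Hf)).
  have H2 : NC (c := c') (fun p => p.2) := computable_snd _ _.
  have H3 : NC (c := c') (fun p => f' p.1.1) := computable_wk _ _ (computable_wk _ _ Hf').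
  have H4 := computable_ite H1 (NC_add H2 H3) H2.
  apply: (computable_ext _ H4) => p i _ _ /=.
  by case: ifP.
move=> g i okg lt_i; rewrite (@foldl_guard _ _ _ (f g)) ?le_f //; last first.
  by move=> x t; rewrite ltnNge => ->.
suff fold n : n <= f g ->
    foldl (fun x t => if t < f g then x + f' g else x) 0 (iota 0 n) = n * f' g.
  by rewrite fold.
elim: n => // n IH lt_n.
by rewrite -addn1 iotaD foldl_cat IH 1?ltnW //= add0n lt_n addn1 mulSn addnC.
Qed.

(** * The algorithms *)

Definition add_elt (A : nat -> bool) (y i : nat) : bool := (i == y) || A i.
Definition empty_set (i : nat) : bool := false.

Section Algorithms.

Variables (n : nat) (adj : nat -> nat -> bool).
Implicit Types (S T Y A : nat -> bool).

Definition mis_test T : bool :=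
  all (fun u => T u == ~~ has (fun v => T v && adj u v) (iota 0 n)) (iota 0 n).

Definition exchange S Y (u : nat) : bool :=
  Y u || ((u < n) && (S u && ~~ has (fun v => Y v && adj u v) (iota 0 n))).

(** Tests [Phi] on [A] enlarged by at most [l] vertices, repetitions allowed. As [l] is fixed, these
    are nested loops of constant depth. *)
Fixpoint all_small (l : nat) (Phi : (nat -> bool) -> bool) A : bool :=
  Phi A && (if l is l'.+1 then
    all (fun y => all_small l' Phi (add_elt A y)) (iota 0 n) else true).

Definition wc_test (l : nat) S : bool :=
  all_small l (fun Y1 => all_small l (fun Y2 =>
    mis_test (exchange S Y1) ==> mis_test (exchange S Y2) ==>
    (count (exchange S Y1) (iota 0 n) == count (exchange S Y2) (iota 0 n)))
    empty_set) empty_set.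

Definition good_edge x y : bool :=
  adj x y && all (fun a => all (fun b => adj x b ==> adj y a ==> adj a b) (iota 0 n)) (iota 0 n).

Definition wc_bip_test : bool :=
  all (fun x => has (adj x) (iota 0 n) ==> has (good_edge x) (iota 0 n) &&
    all (fun y => good_edge x y ==>
      (count (good_edge x) (iota 0 n) == count (good_edge y) (iota 0 n))) (iota 0 n))
  (iota 0 n).

(** [N] will be the input length, the length of a computable loop; rounds [t >= n] add nothing. *)
Definition greedy (N : nat) : nat -> bool :=
  foldl (fun A t i => A i || ((i < n) && ((i == t) && ~~ has (fun v => A v && adj i v) (iota 0 n))))
    empty_set (iota 0 N).

End Algorithms.

(** The vertices that a walk of even length at most [2 * N] joins to [u]. *)
Definition even_walks n (R : nat -> nat -> bool) (N u : nat) : nat -> bool :=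
  foldl (fun A _ x => A x || ((x < n) &&
    has (fun z => A z && has (fun y => R z y && R y x) (iota 0 n)) (iota 0 n)))
    (fun i => i == u) (iota 0 N).

Definition bipartite_test n R N : bool :=
  all (fun u => ~~ has (fun x => even_walks n R N u x && R x u) (iota 0 n)) (iota 0 n).

(** Asks whether [l] cliques cover the complement of [S]; the last case is meant for [l = 2], where
    a cover is a 2-colouring of the complement graph outside [S]. *)
Definition cliques_test n adj N l (S : nat -> bool) : bool :=
  match l with
  | 0 => all S (iota 0 n)
  | 1 => all (fun u => all (fun v => [|| S u, S v, u == v | adj u v]) (iota 0 n)) (iota 0 n)
  | _ => bipartite_test n (fun u v => [&& ~~ S u, ~~ S v, u != v & ~~ adj u v]) N
  end.

Definition split_test n adj N l (S : nat -> bool) : bool :=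
  cliques_test n adj N l S && wc_test n adj l S.

Definition indep_test n adj (S : nat -> bool) : bool :=
  all (fun u => all (fun v => [|| ~~ S u, ~~ S v | ~~ adj u v]) (iota 0 n)) (iota 0 n).

Definition swap (I X Y : nat -> bool) (u : nat) : bool := (I u && ~~ X u) || Y u.

(** An existential search, as a negated [all_small]: some [S], obtained from the greedy set by
    removing and adding at most [l] vertices, is independent and passes [split_test]. *)
Definition rec1_test n adj N l : bool :=
  ~~ all_small n l (fun X => all_small n l (fun Y =>
    let S := swap (greedy n adj N) X Y in
    ~~ (indep_test n adj S && split_test n adj N l S)) empty_set) empty_set.

(** * Computability of the tests *)

Definition vertices c (n : cty c -> nat) : Prop :=
  NC n /\ forall g, cok g -> n g <= clen g.

(** A binary relation does not fit on one track; it is given by its values at computable vertices.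
    Quantifying over all [h] makes it usable under further bound variables. [PC] does the same for
    predicates of sets. *)
Definition RC c (n : cty c -> nat) (R : cty c -> nat -> nat -> bool) : Prop :=
  forall c' (h : cty c' -> cty c), cmorph h -> forall U V, NC U -> NC V ->
    (forall g, cok g -> U g < n (h g)) -> (forall g, cok g -> V g < n (h g)) ->
    BC (fun g => R (h g) (U g) (V g)).

Definition PC c (Phi : cty c -> (nat -> bool) -> bool) : Prop :=
  forall c' (h : cty c' -> cty c), cmorph h -> forall A, computable A ->
    BC (fun g => Phi (h g) (A g)).

Lemma vertices_mor c' c (h : cty c' -> cty c) n :
  cmorph h -> vertices n -> vertices (fun g => n (h g)).
Proof.
move=> [h1 h2 h3] [Hn le_n]; split; first exact: h3 Hn.
by move=> g /h1/le_n; rewrite h2.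
Qed.

Lemma RC_mor c' c (h : cty c' -> cty c) n R :
  cmorph h -> RC n R -> RC (fun g => n (h g)) (fun g => R (h g)).
Proof.
move=> hm HR c2 k km U V HU HV ltU ltV.
exact: (HR c2 (fun g => h (k g)) (cmorph_comp hm km)).
Qed.

Lemma PC_mor c' c (h : cty c' -> cty c) Phi :
  cmorph h -> PC Phi -> PC (fun g => Phi (h g)).
Proof.
move=> hm HR c2 k km A HA.
exact: (HR c2 (fun g => h (k g)) (cmorph_comp hm km)).
Qed.

Lemma computable_mor c' c (h : cty c' -> cty c) F :
  cmorph h -> computable F -> computable (fun g => F (h g)).
Proof. by case=> _ _; apply. Qed.

Lemma cmorph_bound c b : cmorph (c' := @bound c b) fst.
Proof. exact: cmorph_fst. Qed.

Section Tests.

Variables (c : ctx) (n : cty c -> nat).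
Hypothesis Hn : vertices n.

Lemma BC_hasv (P : cty c -> nat -> bool) :
  BC (c := bound n) (fun p => P p.1 p.2) -> BC (fun g => has (P g) (iota 0 (n g))).
Proof. by case: Hn => H1 H2; apply: BC_has. Qed.

Lemma BC_allv (P : cty c -> nat -> bool) :
  BC (c := bound n) (fun p => P p.1 p.2) -> BC (fun g => all (P g) (iota 0 (n g))).
Proof. by case: Hn => H1 H2; apply: BC_all. Qed.

Lemma NC_countv (P : cty c -> nat -> bool) :
  BC (c := bound n) (fun p => P p.1 p.2) -> NC (fun g => count (P g) (iota 0 (n g))).
Proof. by case: Hn => H1 H2; apply: NC_count. Qed.

Lemma SC_comprv (P : cty c -> nat -> bool) :
  BC (c := bound n) (fun p => P p.1 p.2) -> computable (fun g i => (i < n g) && P g i).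
Proof. by case: Hn => H1 H2; apply: computable_compr. Qed.

Lemma count_le_len (P : cty c -> nat -> bool) g : cok g -> count (P g) (iota 0 (n g)) <= clen g.
Proof.
by case: Hn => _ H /H; apply: leq_trans; apply: leq_trans (count_size _ _) _; rewrite size_iota.
Qed.

Lemma BC_in A U : (forall g, cok g -> U g < n g) -> computable A -> NC U -> BC (fun g => A g (U g)).
Proof.
by case: Hn => _ le_n ltU; apply: BC_mem => g okg; apply: leq_trans (ltU g okg) (le_n g okg).
Qed.

Lemma BC_eqv U V : (forall g, cok g -> U g < n g) -> (forall g, cok g -> V g < n g) ->
  NC U -> NC V -> BC (fun g => U g == V g).
Proof.
case: Hn => _ le_n ltU ltV; apply: BC_eq => g okg.
  exact: leq_trans (ltnW (ltU g okg)) (le_n g okg).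
exact: leq_trans (ltnW (ltV g okg)) (le_n g okg).
Qed.

End Tests.

Ltac side := first
  [ by move=> g []; intuition auto
  | by move=> g [[]]; intuition auto
  | by move=> g [[[]]]; intuition auto ].

Section Tests2.

Variables (c : ctx) (n : cty c -> nat) (R : cty c -> nat -> nat -> bool).
Hypotheses (Hn : vertices n) (HR : RC n R).

Let m1 := cmorph_bound n.
Let Hn1 : vertices (c := bound n) (fun p => n p.1) := vertices_mor m1 Hn.
Let m2 := cmorph_bound (fun p : cty (bound n) => n p.1).
Let Hn2 := vertices_mor m2 Hn1.

Lemma BC_mis T : computable T -> BC (fun g => mis_test (n g) (R g) (T g)).
Proof.
move=> HT; apply: (BC_allv Hn); apply: BC_eqb.
  by apply: (BC_in Hn1 (A := fun p => T p.1)) (computable_mor m1 HT) (NC_snd _); side.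
apply: BC_not; apply: (BC_hasv Hn1 (P := fun p v => T p.1 v && R p.1 p.2 v)).
apply: BC_and.
  apply: (BC_in Hn2 (A := fun p => T p.1.1)) (computable_mor m2 (computable_mor m1 HT)) (NC_snd _).
  by side.
apply: (HR (cmorph_comp m1 m2)); [exact: computable_mor m2 (NC_snd _) | exact: NC_snd | side | side].
Qed.

Lemma computable_exchange S Y : computable S -> computable Y ->
  computable (fun g => exchange (n g) (R g) (S g) (Y g)).
Proof.
move=> HS HY; apply: computable_or => //.
apply: (SC_comprv Hn (P := fun g u => S g u && ~~ has (fun v => Y g v && R g u v) (iota 0 (n g)))).
apply: BC_and.
  by apply: (BC_in Hn1 (A := fun p => S p.1)) (computable_mor m1 HS) (NC_snd _); side.
apply: BC_not; apply: (BC_hasv Hn1 (P := fun p v => Y p.1 v && R p.1 p.2 v)).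
apply: BC_and.
  by apply: (BC_in Hn2 (A := fun p => Y p.1.1)) (computable_mor m2 (computable_mor m1 HY)) (NC_snd _); side.
apply: (HR (cmorph_comp m1 m2)); [exact: computable_mor m2 (NC_snd _) | exact: NC_snd | side | side].
Qed.

Lemma computable_count A : computable A -> NC (fun g => count (A g) (iota 0 (n g))).
Proof.
move=> HA; apply: (NC_countv Hn (P := fun g u => A g u)).
by apply: (BC_in Hn1 (A := fun p => A p.1)) (computable_mor m1 HA) (NC_snd _); side.
Qed.

Lemma BC_exchange_test S Y1 Y2 : computable S -> computable Y1 -> computable Y2 ->
  BC (fun g => let T1 := exchange (n g) (R g) (S g) (Y1 g) in
     let T2 := exchange (n g) (R g) (S g) (Y2 g) in
     mis_test (n g) (R g) T1 ==> mis_test (n g) (R g) T2 ==>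
     (count T1 (iota 0 (n g)) == count T2 (iota 0 (n g)))).
Proof.
move=> HS HY1 HY2; have H1 := computable_exchange HS HY1; have H2 := computable_exchange HS HY2.
apply: BC_imp; first exact: BC_mis.
apply: BC_imp; first exact: BC_mis.
apply: BC_eq.
- by move=> g okg; exact: (count_le_len Hn (fun g => exchange (n g) (R g) (S g) (Y1 g)) okg).
- by move=> g okg; exact: (count_le_len Hn (fun g => exchange (n g) (R g) (S g) (Y2 g)) okg).
- exact: computable_count.
- exact: computable_count.
Qed.

(** Stated in the form of [RC] for [good_edge], since it is applied below different numbers of
    quantifiers. *)
Lemma BC_good_edge c' (h : cty c' -> cty c) (hm : cmorph h) U V : NC U -> NC V ->
  (forall g, cok g -> U g < n (h g)) -> (forall g, cok g -> V g < n (h g)) ->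
  BC (fun g => good_edge (n (h g)) (R (h g)) (U g) (V g)).
Proof.
move=> HU HV ltU ltV.
have H' := vertices_mor hm Hn.
have k1 := cmorph_bound (fun g => n (h g)).
have H'1 : vertices (c := bound (fun g => n (h g))) (fun p => n (h p.1)) := vertices_mor k1 H'.
have k2 := cmorph_bound (fun p : cty (bound (fun g => n (h g))) => n (h p.1)).
apply: BC_and; first exact: HR.
apply: (BC_allv H' (P := fun g a => all (fun b => R (h g) (U g) b ==> R (h g) (V g) a ==> R (h g) a b)
  (iota 0 (n (h g))))).
apply: (BC_allv H'1 (P := fun p b => R (h p.1) (U p.1) b ==> R (h p.1) (V p.1) p.2 ==> R (h p.1) p.2 b)).
have km := cmorph_comp hm (cmorph_comp k1 k2).
have HU2 := computable_mor k2 (computable_mor k1 HU).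
have HV2 := computable_mor k2 (computable_mor k1 HV).
have Va := computable_mor k2 (NC_snd (fun g => n (h g))).
have Vb := NC_snd (fun p : cty (bound (fun g => n (h g))) => n (h p.1)).
by apply: BC_imp; [|apply: BC_imp]; apply: (HR km) => //; move=> [[g a] b] /= [[okg ?] ?] //; auto.
Qed.

Lemma BC_wc_bip : BC (fun g => wc_bip_test (n g) (R g)).
Proof.
apply: (BC_allv Hn (P := fun g x => has (R g x) (iota 0 (n g)) ==>
  has (good_edge (n g) (R g) x) (iota 0 (n g)) && all (fun y => good_edge (n g) (R g) x y ==>
  (count (good_edge (n g) (R g) x) (iota 0 (n g)) ==
   count (good_edge (n g) (R g) y) (iota 0 (n g)))) (iota 0 (n g)))).
have V1 := computable_mor m2 (NC_snd n).
have V2 := NC_snd (fun p : cty (bound n) => n p.1).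
apply: BC_imp.
  apply: (BC_hasv Hn1 (P := fun p v => R p.1 p.2 v)).
  by apply: (HR (cmorph_comp m1 m2)) => //; side.
apply: BC_and.
  apply: (BC_hasv Hn1 (P := fun p v => good_edge (n p.1) (R p.1) p.2 v)).
  by apply: (BC_good_edge (cmorph_comp m1 m2)) => //; side.
apply: (BC_allv Hn1 (P := fun p y => good_edge (n p.1) (R p.1) p.2 y ==>
  (count (good_edge (n p.1) (R p.1) p.2) (iota 0 (n p.1)) ==
   count (good_edge (n p.1) (R p.1) y) (iota 0 (n p.1))))).
apply: BC_imp; first by apply: (BC_good_edge (cmorph_comp m1 m2)) => //; side.
have m3 := cmorph_bound (fun p : cty (bound (fun p : cty (bound n) => n p.1)) => n p.1.1).
have V3 := NC_snd (fun p : cty (bound (fun p : cty (bound n) => n p.1)) => n p.1.1).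
have V31 := computable_mor m3 V1.
have V32 := computable_mor m3 V2.
have mm := cmorph_comp m1 (cmorph_comp m2 m3).
apply: BC_eq.
- by move=> p okp; apply: (count_le_len Hn2 (fun p => good_edge (n p.1.1) (R p.1.1) p.1.2) okp).
- by move=> p okp; apply: (count_le_len Hn2 (fun p => good_edge (n p.1.1) (R p.1.1) p.2) okp).
- apply: (NC_countv Hn2 (P := fun p v => good_edge (n p.1.1) (R p.1.1) p.1.2 v)).
  by apply: (BC_good_edge mm) => //; side.
apply: (NC_countv Hn2 (P := fun p v => good_edge (n p.1.1) (R p.1.1) p.2 v)).
by apply: (BC_good_edge mm) => //; side.
Qed.

Lemma computable_greedy : computable (fun g => greedy (n g) (R g) (clen g)).
Proof.
pose den (A : nat -> bool) := A.
apply: (@computable_iter c (nat -> bool) den (fun=> empty_set) (fun g t A i => A i ||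
  ((i < n g) && ((i == t) && ~~ has (fun v => A v && R g i v) (iota 0 (n g)))))).
  exact: computable_const.
have kI : cmorph (c' := iter_ctx c den) (fun p => p.1.1).
  exact: cmorph_comp (cmorph_fst _ _) (cmorph_fst _ _).
have HnI := vertices_mor kI Hn.
have HA : computable (c := iter_ctx c den) (fun p => p.2) := computable_snd _ _.
apply: computable_or => //.
apply: (SC_comprv HnI (P := fun p i => (i == p.1.2) &&
  ~~ has (fun v => p.2 v && R p.1.1 i v) (iota 0 (n p.1.1)))).
set b1 := fun p : cty (iter_ctx c den) => n p.1.1.
have k1 := cmorph_bound b1; have Hn1' := vertices_mor k1 HnI.
apply: BC_and.
  apply: BC_eq; last exact: (computable_mor k1 (computable_wk _ _ (NC_snd _))).
  - move=> [[[g t] A] i] [[[okg ?] ?]] /= lt_i; case: Hn => _ /(_ g okg).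
    by apply: leq_trans; apply: ltnW.
  - by move=> [[[g t] A] i] [[[okg ?] ?]] /= lt_i; apply: ltnW.
  exact: NC_snd.
apply: BC_not; apply: (BC_hasv Hn1' (P := fun q v => q.1.2 v && R q.1.1.1 q.2 v)).
set b2 := fun q : cty (bound b1) => n q.1.1.1.
have k2 := cmorph_bound b2; have Hn2' := vertices_mor k2 Hn1'.
apply: BC_and.
  by apply: (BC_in Hn2' (A := fun q => q.1.1.2)) (computable_mor k2 (computable_mor k1 HA)) (NC_snd _) => g [].
apply: (HR (cmorph_comp kI (cmorph_comp k1 k2))).
- exact: computable_mor k2 (NC_snd _).
- exact: NC_snd.
- by move=> g [[]].
- by move=> g [].
Qed.

Lemma BC_bipartite : BC (fun g => bipartite_test (n g) (R g) (clen g)).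
Proof.
pose den (A : nat -> bool) := A.
apply: (BC_allv Hn (P := fun g u =>
  ~~ has (fun x => even_walks (n g) (R g) (clen g) u x && R g x u) (iota 0 (n g)))).
apply: BC_not; apply: (BC_hasv Hn1 (P := fun p x =>
  even_walks (n p.1) (R p.1) (clen p.1) p.2 x && R p.1 x p.2)).
apply: BC_and; last first.
  apply: (HR (cmorph_comp m1 m2)); [exact: NC_snd | exact: computable_mor m2 (NC_snd _) | side | side].
apply: (BC_in Hn2 (A := fun p => even_walks (n p.1.1) (R p.1.1) (clen p.1.1) p.1.2)) (NC_snd _).
  by side.
suff HE : computable (c := bound n) (fun p => even_walks (n p.1) (R p.1) (clen p.1) p.2).
  exact: (computable_mor m2 HE).
apply: (@computable_iter (bound n) (nat -> bool) den (fun p i => i == p.2) (fun p t A x => A x ||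
  ((x < n p.1) && has (fun z => A z && has (fun y => R p.1 z y && R p.1 y x) (iota 0 (n p.1)))
     (iota 0 (n p.1))))).
  exact: computable_eq (NC_snd _).
set c' := iter_ctx (bound n) den.
have kI : cmorph (c' := c') (c := bound n) (fun p => p.1.1).
  exact: cmorph_comp (cmorph_fst _ _) (cmorph_fst _ _).
have HnI := vertices_mor kI Hn1.
have HA : computable (c := c') (fun p => p.2) := computable_snd _ _.
apply: computable_or => //.
apply: (SC_comprv HnI (P := fun p x => has (fun z => p.2 z &&
  has (fun y => R p.1.1.1 z y && R p.1.1.1 y x) (iota 0 (n p.1.1.1))) (iota 0 (n p.1.1.1)))).
set b1 := fun p : cty c' => n p.1.1.1.
have k1 := cmorph_bound b1; have Hn1' := vertices_mor k1 HnI.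
apply: (BC_hasv Hn1' (P := fun q z => q.1.2 z &&
  has (fun y => R q.1.1.1.1 z y && R q.1.1.1.1 y q.2) (iota 0 (n q.1.1.1.1)))).
set b2 := fun q : cty (bound b1) => n q.1.1.1.1.
have k2 := cmorph_bound b2; have Hn2' := vertices_mor k2 Hn1'.
apply: BC_and.
  by apply: (BC_in Hn2' (A := fun q => q.1.1.2)) (computable_mor k2 (computable_mor k1 HA)) (NC_snd _) => g [].
apply: (BC_hasv Hn2' (P := fun q y => R q.1.1.1.1.1 q.2 y && R q.1.1.1.1.1 y q.1.2)).
set b3 := fun q : cty (bound b2) => n q.1.1.1.1.1.
have k3 := cmorph_bound b3.
have km := cmorph_comp m1 (cmorph_comp kI (cmorph_comp k1 (cmorph_comp k2 k3))).
apply: BC_and; apply: (HR km).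
- exact: computable_mor k3 (NC_snd _).
- exact: NC_snd.
- by move=> g [[]].
- by move=> g [].
- exact: NC_snd.
- exact: (computable_mor k3 (computable_mor k2 (NC_snd _))).
- by move=> g [].
- by move=> g [[[]]].
Qed.

End Tests2.

(** Each level of the induction extends the context by one vertex, so contexts, [Phi] and [A] vary
    in the induction hypothesis. *)
Lemma BC_all_small l c n (Phi : cty c -> (nat -> bool) -> bool) A :
  vertices n -> PC Phi -> computable A ->
  BC (fun g => all_small (n g) l (Phi g) (A g)).
Proof.
elim: l c n Phi A => [|l IH] c n Phi A Hn HP HA.
  by apply: BC_and; [exact: (HP c id (cmorph_id c)) | exact: computable_const].
apply: BC_and; first exact: (HP c id (cmorph_id c)).
have k1 := cmorph_bound n; have Hn1 := vertices_mor k1 Hn.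
apply: (BC_allv Hn (P := fun g y => all_small (n g) l (Phi g) (add_elt (A g) y))).
apply: (IH (bound n) (fun p => n p.1) (fun p => Phi p.1) (fun p => add_elt (A p.1) p.2)) => //.
  exact: PC_mor k1 HP.
apply: computable_or; last exact: computable_mor k1 HA.
exact: computable_eq (NC_snd _).
Qed.

Section Tests3.

Variables (c : ctx) (n : cty c -> nat) (R : cty c -> nat -> nat -> bool).
Hypotheses (Hn : vertices n) (HR : RC n R).

Let m1 := cmorph_bound n.
Let Hn1 : vertices (c := bound n) (fun p => n p.1) := vertices_mor m1 Hn.
Let m2 := cmorph_bound (fun p : cty (bound n) => n p.1).
Let Hn2 := vertices_mor m2 Hn1.

Lemma BC_wc l S : computable S -> BC (fun g => wc_test (n g) (R g) l (S g)).
Proof.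
move=> HS; apply: BC_all_small => //; last exact: computable_const.
move=> c1 h1 hm1 Y1 HY1.
apply: (BC_all_small (Phi := fun g Y2 => _) l (vertices_mor hm1 Hn)); last exact: computable_const.
move=> c2 h2 hm2 Y2 HY2.
have hm := cmorph_comp hm1 hm2.
apply: (BC_exchange_test (vertices_mor hm Hn) (RC_mor hm HR)) => //.
  exact: computable_mor hm HS.
exact: (computable_mor hm2 HY1).
Qed.

Lemma BC_cliques l S : computable S -> BC (fun g => cliques_test (n g) (R g) (clen g) l (S g)).
Proof.
move=> HS; have HS1 := computable_mor m1 HS; have HS2 := computable_mor m2 HS1.
case: l => [|[|l]] /=.
- apply: (BC_allv Hn (P := fun g u => S g u)).
  by apply: (BC_in Hn1 (A := fun p => S p.1)) HS1 (NC_snd _); side.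
- apply: (BC_allv Hn (P := fun g u => all (fun v => [|| S g u, S g v, u == v | R g u v]) (iota 0 (n g)))).
  apply: (BC_allv Hn1 (P := fun p v => [|| S p.1 p.2, S p.1 v, p.2 == v | R p.1 p.2 v])).
  have V1 := computable_mor m2 (NC_snd n).
  have V2 := NC_snd (fun p : cty (bound n) => n p.1).
  apply: BC_or; first by apply: (BC_in Hn2 (A := fun p => S p.1.1)) HS2 V1; side.
  apply: BC_or; first by apply: (BC_in Hn2 (A := fun p => S p.1.1)) HS2 V2; side.
  apply: BC_or; first by apply: (BC_eqv Hn2) V1 V2; side.
  by apply: (HR (cmorph_comp m1 m2)) => //; side.
apply: (BC_bipartite Hn (R := fun g u v => [&& ~~ S g u, ~~ S g v, u != v & ~~ R g u v])).
move=> c' h hm U V HU HV ltU ltV.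
have HSh := computable_mor hm HS; have Hnh := vertices_mor hm Hn.
apply: BC_and; first by apply: BC_not; apply: (BC_in Hnh (A := fun g => S (h g))) HSh HU.
apply: BC_and; first by apply: BC_not; apply: (BC_in Hnh (A := fun g => S (h g))) HSh HV.
apply: BC_and; first by apply: BC_not; apply: (BC_eqv Hnh) HU HV.
by apply: BC_not; apply: HR.
Qed.

Lemma BC_split l S : computable S -> BC (fun g => split_test (n g) (R g) (clen g) l (S g)).
Proof. by move=> HS; apply: BC_and; [exact: BC_cliques | exact: BC_wc]. Qed.

Lemma BC_indep S : computable S -> BC (fun g => indep_test (n g) (R g) (S g)).
Proof.
move=> HS; have HS1 := computable_mor m1 HS; have HS2 := computable_mor m2 HS1.
apply: (BC_allv Hn (P := fun g u => all (fun v => [|| ~~ S g u, ~~ S g v | ~~ R g u v]) (iota 0 (n g)))).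
apply: (BC_allv Hn1 (P := fun p v => [|| ~~ S p.1 p.2, ~~ S p.1 v | ~~ R p.1 p.2 v])).
have V1 := computable_mor m2 (NC_snd n).
have V2 := NC_snd (fun p : cty (bound n) => n p.1).
apply: BC_or; first by apply: BC_not; apply: (BC_in Hn2 (A := fun p => S p.1.1)) HS2 V1; side.
apply: BC_or; first by apply: BC_not; apply: (BC_in Hn2 (A := fun p => S p.1.1)) HS2 V2; side.
by apply: BC_not; apply: (HR (cmorph_comp m1 m2)) => //; side.
Qed.

End Tests3.

Lemma BC_rec1 c n R l : vertices n -> RC n R ->
  BC (c := c) (fun g => rec1_test (n g) (R g) (clen g) l).
Proof.
move=> Hn HR; apply: BC_not; apply: BC_all_small => //; last exact: computable_const.
move=> c1 h1 hm1 X HX.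
apply: (BC_all_small (Phi := fun g Y => _) l (vertices_mor hm1 Hn)); last exact: computable_const.
move=> c2 h2 hm2 Y HY; have hm := cmorph_comp hm1 hm2.
have Hn2 := vertices_mor hm Hn; have HR2 := RC_mor hm HR.
pose S g := swap (greedy (n (h1 (h2 g))) (R (h1 (h2 g))) (clen g)) (X (h2 g)) (Y g).
have HS : computable S.
  apply: computable_or => //; apply: computable_and; first exact: computable_greedy.
  exact: computable_not (computable_mor hm2 HX).
have [_ len_h _] := hm.
apply: BC_ext (BC_not (BC_and (BC_indep Hn2 HR2 HS) (BC_split Hn2 HR2 l HS))) => g _.
by rewrite /S len_h.
Qed.

(** * Reading the input *)

Section Input.

Variables (I : Type) (Valid : I -> Prop) (enc : I -> seq bool).

Definition input : ctx := @Ctx I (fun x => size (enc x))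
  (fun x => Valid x /\ 0 < size (enc x)) [:: fun x i => nth false (enc x) i].

(** The input is placed on track 0 with all other tracks unset; [P] is computed in track 1, and a
    final test reads it off. *)
Lemma poly_time_BC (P : I -> bool) (Q : I -> Prop) :
  BC (c := input) P ->
  (forall x, Valid x -> 0 < size (enc x) -> (P x <-> Q x)) ->
  (forall x, Valid x -> size (enc x) = 0 -> Q x) ->
  poly_time_solvable Valid enc Q.
Proof.
move=> [w HP] PQ Q0; have D := HP (1 + w) 1 [:: 0] isT (leqnn _) erefl.
pose inj (b : bool) : cell (1 + w) := [ffun i => (val i == 0) && b].
apply: (poly_time_doable (inj := inj) (doable_seq D (@doable_test (1 + w) 1 id))) => // x s' b Vx x_gt0.
move=> [s1 [_ [sz1 [_ /(_ x) H1] [_ ->]]]]; rewrite H1 ?has_map.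
  have -> : has (preim (fun=> P x) id) (iota 0 (clen (c := input) x)) = P x.
    rewrite /=; case: (size _) x_gt0 => // k _ /=; case: (P x) => //=.
    by elim: (iota _ _).
  exact: PQ.
split; rewrite ?size_map //=; congr (_ :: _); rewrite mkseq_nth /track -map_comp.
rewrite -[RHS]map_id; apply: eq_map => a; rewrite /= /get.
case: insubP => [i _ Ei|//]; by rewrite ffunE Ei eqxx.
Qed.

Variables (n : I -> nat) (L : nat).
Hypothesis size_enc : forall x, Valid x -> size (enc x) = n x * n x + n x * L.

(** The vertex number is recovered from the input length [N = n * n + n * L] as the number of
    [m < N] with [m * m + m * L < N]. *)
Lemma vertices_input : vertices (c := input) n.
Proof.
have len_n g : cok (c := input) g -> n g <= clen g.
  by move=> [Vg] /=; rewrite size_enc //; nia.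
split=> //; pose c1 := bound (c := input) (@clen input).
have all_le g : cok (c := input) g -> clen g <= clen g by [].
have Hlen : NC (@clen input).
  apply: computable_ext (computable_const input true) => g i _ lt_i.
  by rewrite /thermo lt_i.
have Hm : NC (c := c1) (fun p => p.2 * p.2 + p.2 * L).
  apply: NC_add; apply: NC_mul; try exact: NC_snd; try exact: NC_const.
    by move=> g [_ /ltnW].
  by move=> g [_ /ltnW].
have Hc := NC_count (P := fun g m => m * m + m * L < clen g) Hlen all_le
  (BC_lt (c := c1) (f' := fun p => clen p.1) (fun g _ => leqnn _) Hm (computable_mor (cmorph_bound _) Hlen)).
apply: NC_ext Hc => g [Vg g_gt0].
have En : clen g = n g * n g + n g * L by rewrite /= size_enc.
have le_n : n g <= clen g by apply: len_n.
rewrite -[X in iota 0 X](subnKC le_n) iotaD count_cat add0n.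
have -> : count (fun m => m * m + m * L < clen g) (iota 0 (n g)) = n g.
  rewrite -[RHS](size_iota 0); apply/eqP; rewrite -all_count; apply/allP => m.
  by rewrite mem_iota add0n En => lt_m; nia.
rewrite -[RHS]addn0; congr (_ + _); apply/eqP; rewrite -leqn0 leqNgt -has_count.
apply/hasPn => m; rewrite mem_iota => /andP[le_m _]; rewrite -leqNgt En.
by nia.
Qed.

Lemma BC_bit c (h : cty c -> I) (k : cty c -> nat) : cmorph (c := input) h -> NC k ->
  (forall g, cok g -> k g < size (enc (h g))) -> BC (fun g => nth false (enc (h g)) (k g)).
Proof.
move=> hm Hk ltk; have [_ len_h _] := hm.
apply: (BC_mem (A := fun g i => nth false (enc (h g)) i)) => //.
  by move=> g okg; rewrite -len_h; apply: ltk.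
exact: (computable_mor hm (@computable_var input 0 isT)).
Qed.

Definition matrix_bit (x : I) (u v : nat) : bool := nth false (enc x) (u * n x + v).

Lemma RC_input : RC (c := input) n matrix_bit.
Proof.
move=> c h hm U V HU HV ltU ltV; have [ok_h _ _] := hm.
have [Hn le_n] := vertices_mor hm vertices_input.
apply: BC_bit => //.
  apply: NC_add => //; apply: NC_mul => // g okg.
  by apply: leq_trans (le_n g okg); apply: ltnW (ltU g okg).
move=> g okg; have := ltU g okg; have := ltV g okg; have [Vg _] := ok_h g okg.
by rewrite size_enc // => *; nia.
Qed.

Definition label_bit (k : nat) (x : I) (u : nat) : bool :=
  nth false (enc x) (n x * n x + (u * L + k)).

Lemma computable_label k : k < L ->
  computable (c := input) (fun x u => (u < n x) && label_bit k x u).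
Proof.
move=> lt_k; have Hn := vertices_input; have [Hn1 le_n] := Hn.
apply: (SC_comprv Hn).
have m1 := cmorph_bound (c := input) n.
have [H1 le_n1] := vertices_mor m1 Hn.
apply: (BC_bit m1).
  apply: NC_add; first exact: NC_mul.
  apply: NC_add; last exact: NC_const.
  apply: NC_mul; [|exact: NC_snd|exact: NC_const].
  by move=> g okg; apply: leq_trans (le_n1 g okg); case: okg => _ /ltnW.
move=> [x u] [[Vx _] /= lt_u]; rewrite size_enc //; nia.
Qed.

End Input.

Lemma size_enc_graph n (adj : 'I_n -> 'I_n -> bool) : size (enc_graph adj) = n * n.
Proof. by rewrite size_allpairs size_enum_ord. Qed.

Lemma nth_allpairs_ord n (T : Type) (x0 : T) (f : 'I_n -> 'I_n -> T) (u v : 'I_n) :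
  nth x0 [seq f a b | a <- enum 'I_n, b <- enum 'I_n] (u * n + v) = f u v.
Proof.
suff gen s k : k < size s ->
    nth x0 [seq f a b | a <- s, b <- enum 'I_n] (k * n + v) = f (nth u s k) v.
  by rewrite gen ?size_enum_ord ?nth_ord_enum.
elim: s k => [|a s IH] [|k] //=.
  by move=> _; rewrite mul0n add0n nth_cat size_map size_enum_ord ltn_ord (nth_map v) ?size_enum_ord // nth_ord_enum.
rewrite ltnS => lt_k; rewrite nth_cat size_map size_enum_ord mulSn -addnA ltnNge leq_addr /=.
by rewrite addKn IH.
Qed.

Lemma nth_flatten_ord n l (T : Type) (x0 : T) (F : 'I_n -> seq T) (u : 'I_n) k :
  (forall v, size (F v) = l) -> k < l ->
  nth x0 (flatten [seq F v | v <- enum 'I_n]) (u * l + k) = nth x0 (F u) k.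
Proof.
move=> szF lt_k; suff gen s j : j < size s ->
    nth x0 (flatten [seq F v | v <- s]) (j * l + k) = nth x0 (F (nth u s j)) k.
  by rewrite gen ?size_enum_ord ?nth_ord_enum.
elim: s j => [|a s IH] [|j] //=; first by move=> _; rewrite mul0n add0n nth_cat szF lt_k.
rewrite ltnS => lt_j; rewrite nth_cat szF mulSn -addnA ltnNge leq_addr /=.
by rewrite addKn IH.
Qed.

(** * Correctness: an independent set and cliques *)

Section OrdinalSets.

Variable n : nat.
Implicit Types P : nat -> bool.

Definition vertex_set P : {set 'I_n} := [set u : 'I_n | P u].

Lemma has_iota_ord P : has P (iota 0 n) = [exists u : 'I_n, P u].
Proof.
apply/hasP/existsP => [[u]|[u Pu]]; last by exists (val u); rewrite // mem_iota ltn_ord.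
by rewrite mem_iota => lt_u Pu; exists (Ordinal lt_u).
Qed.

Lemma all_iota_ord P : all P (iota 0 n) = [forall u : 'I_n, P u].
Proof.
apply/allP/forallP => [H u|H u]; first by apply: H; rewrite mem_iota ltn_ord.
by rewrite mem_iota => lt_u; apply: (H (Ordinal lt_u)).
Qed.

Lemma count_iota_ord P : count P (iota 0 n) = #|vertex_set P|.
Proof. by rewrite -val_enum_ord count_map cardsE cardE size_filter enumT. Qed.

Lemma all_smallP l (Phi : pred (nat -> bool)) A :
  reflect (forall s, size s <= l -> all (fun i => i < n) s -> Phi (foldl add_elt A s))
    (all_small n l Phi A).
Proof.
elim: l A => [|l IH] A /=.
  rewrite andbT; apply: (iffP idP) => [PA [|//]//|]; exact: (fun H => H [::] isT isT).
apply: (iffP andP) => [[PA /allP H] [//|y s] /= le_s /andP[lt_y lt_s]|H].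
  have /IH : all_small n l Phi (add_elt A y) by apply: H; rewrite mem_iota.
  by apply.
split; first exact: (H [::]).
apply/allP => y; rewrite mem_iota => lt_y; apply/IH => s le_s lt_s.
by apply: (H (y :: s)); rewrite //= lt_s andbT.
Qed.

Lemma foldl_add_elt A s i : foldl add_elt A s i = (i \in s) || A i.
Proof. by elim: s A => //= y s IH A; rewrite IH in_cons /add_elt orbCA orbA. Qed.

Lemma small_set_seq (Y : {set 'I_n}) l : #|Y| <= l ->
  exists s, [/\ size s <= l, all (fun i => i < n) s &
    forall u : 'I_n, foldl add_elt empty_set s u = (u \in Y)].
Proof.
move=> le_Y; exists (map val (enum Y)); rewrite size_map -cardE; split=> //.
  by apply/allP => _ /mapP[u _ ->]; apply: ltn_ord.
by move=> u; rewrite foldl_add_elt orbF mem_map ?mem_enum //; apply: val_inj.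
Qed.

End OrdinalSets.

Section Graph.

Variables (n : nat) (e : 'I_n -> 'I_n -> bool) (g : nat -> nat -> bool).
Hypotheses (simple_e : simple_graph e) (ge : forall u v : 'I_n, g u v = e u v).

Let e_sym u v : e u v = e v u. Proof. by case: simple_e. Qed.
Let e_irr u : e u u = false. Proof. by case: simple_e. Qed.

Lemma independentP (S : {set 'I_n}) :
  reflect (forall u v, u \in S -> v \in S -> e u v = false) (independent e S).
Proof.
apply: (iffP forall_inP) => [H u v uS vS|H u uS].
  by apply/negbTE; have /forall_inP := H u uS; apply.
by apply/forall_inP => v vS; rewrite H.
Qed.

Lemma maximal_independentP (S : {set 'I_n}) :
  reflect (forall u, (u \in S) = ~~ [exists v, (v \in S) && e u v]) (maximal_independent e S).
Proof.
apply: (iffP andP) => [[/independentP iS /forallP maxS] u|H].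
  apply/idP/idP => [uS|].
    by apply/existsPn => v; apply/andP => -[vS]; rewrite iS.
  move/existsPn => Hu; apply/negPn/negP => uNS.
  have /implyP := maxS (u |: S); rewrite properE subsetUr subUset sub1set (negPf uNS) => /(_ isT) /negP; apply.
  apply/independentP => x y /setU1P[->|xS] /setU1P[->|yS].
  - exact: e_irr.
  - by have := Hu y; rewrite yS /= => /negbTE.
  - by rewrite e_sym; have := Hu x; rewrite xS /= => /negbTE.
  - exact: iS.
split.
  apply/independentP => u v uS vS; apply/negbTE/negP => uv.
  by move: uS; rewrite H => /existsPn /(_ v); rewrite vS uv.
apply/forallP => T; apply/implyP => /properP[ST [u uT]]; rewrite H negbK.
case/existsP => v /andP[vS uv]; apply/negP => /independentP /(_ u v uT (subsetP ST v vS)).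
by rewrite uv.
Qed.

Lemma maximal_indep S : maximal_independent e S -> independent e S.
Proof. by case/andP. Qed.

Lemma extend_independent (S : {set 'I_n}) :
  independent e S -> exists2 T, maximal_independent e T & S \subset T.
Proof.
move=> iS; have [T maxT ST] := maxset_exists (P := independent e) iS.
exists T => //; have /maxsetP[iT mT] := maxT.
rewrite /maximal_independent iT; apply/forallP => U; apply/implyP => ltTU.
apply/negP => iU; move: ltTU; rewrite properE => /andP[TU /negP]; apply.
by rewrite (mT U iU TU).
Qed.

Lemma mis_testE T : mis_test n g T = maximal_independent e (vertex_set n T).
Proof.
rewrite /mis_test all_iota_ord; apply/forallP/maximal_independentP => H u.
  move/eqP: (H u); rewrite inE has_iota_ord => ->; congr (~~ _).
  by apply: eq_existsb => v; rewrite inE ge.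
move: (H u); rewrite inE has_iota_ord => ->; apply/eqP; congr (~~ _).
by apply: eq_existsb => v; rewrite inE ge.
Qed.

(** A vertex of [S] lies in [T] iff it has no neighbour in [T], and such neighbours lie outside [S],
    hence in [Y]. *)
Lemma exchange_diff S T Y : independent e (vertex_set n S) -> maximal_independent e T ->
  (forall u : 'I_n, Y (val u) = (u \in T :\: vertex_set n S)) -> vertex_set n (exchange n g S Y) = T.
Proof.
move=> iS mT EY; apply/setP => u; rewrite inE /exchange EY has_iota_ord ltn_ord !inE /=.
case: (boolP (S u)) => /= Su; last by rewrite orbF.
have /maximal_independentP -> := mT; congr (~~ _); apply/existsP/existsP => -[v /andP[]].
  by rewrite EY ge !inE => /andP[_ vT uv]; exists v; rewrite vT.
move=> vT uv; exists v; rewrite EY ge !inE vT uv !andbT.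
by apply/negP => Sv; move/independentP: iS => /(_ u v); rewrite !inE uv => /(_ Su Sv).
Qed.

Lemma wc_testP l S : independent e (vertex_set n S) ->
  (forall T, independent e T -> #|T :\: vertex_set n S| <= l) ->
  wc_test n g l S <-> well_covered e.
Proof.
move=> iS bound; split=> [H T1 T2 m1 m2|wc].
  have [s1 [le1 lt1 E1]] := small_set_seq (bound T1 (maximal_indep m1)).
  have [s2 [le2 lt2 E2]] := small_set_seq (bound T2 (maximal_indep m2)).
  have /all_smallP /(_ s1 le1 lt1) /all_smallP /(_ s2 le2 lt2) := H.
  rewrite !mis_testE !count_iota_ord (exchange_diff iS m1 E1) (exchange_diff iS m2 E2).
  by rewrite m1 m2 => /eqP.
apply/all_smallP => s1 _ _; apply/all_smallP => s2 _ _.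
rewrite !mis_testE !count_iota_ord; apply/implyP => m1; apply/implyP => m2.
by apply/eqP; apply: wc.
Qed.

Definition clique_cover (l : nat) (S : {set 'I_n}) : Prop :=
  exists h : 'I_n -> nat, (forall u, u \notin S -> h u < l) /\
    (forall u v, u \notin S -> v \notin S -> u != v -> h u = h v -> e u v).

(** Two vertices of [T] outside [S] never share a clique, so [h] maps them injectively into [l]
    values. *)
Lemma clique_cover_bound l S T : clique_cover l S -> independent e T -> #|T :\: S| <= l.
Proof.
move=> [h [lt_h cl_h]] /independentP iT.
rewrite cardE -(size_map h) -[X in _ <= X](size_iota 0); apply: uniq_leq_size.
  rewrite map_inj_in_uniq ?enum_uniq // => u v; rewrite !mem_enum !inE.
  move=> /andP[uS uT] /andP[vS vT] E; apply/eqP/negPn/negP => ne.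
  by have := cl_h u v uS vS ne E; rewrite iT.
move=> k /mapP[u]; rewrite mem_enum inE => /andP[uS _] ->.
by rewrite mem_iota lt_h.
Qed.

Lemma partition_clique_cover r l (f : 'I_n -> 'I_(r + l)) : is_rl_partition e r l f ->
  clique_cover l [set u | f u < r].
Proof.
move=> [_ cl]; exists (fun u => f u - r); split=> [u|u v]; rewrite !inE -!leqNgt.
  by move=> le_r; rewrite ltn_subLR.
move=> le_u le_v ne E.
have lt_j : f u - r < l by rewrite ltn_subLR.
have Ev : val (f v) = r + (f u - r) by rewrite E subnKC.
have uj : u \in part f (r + (f u - r)) by rewrite inE subnKC.
have vj : v \in part f (r + (f u - r)) by rewrite inE Ev.
by have /forall_inP/(_ u uj)/forall_inP/(_ v vj)/implyP := cl _ lt_j; apply.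
Qed.

Lemma rl_graph0 l : rl_graph e 0 l <-> clique_cover l set0.
Proof.
split=> [[f /partition_clique_cover]|[h [lt_h cl_h]]].
  by have -> : [set u | f u < 0] = set0 by apply/setP=> u; rewrite !inE.
have lt u : h u < 0 + l by apply: lt_h; rewrite inE.
exists (fun u => Ordinal (lt u)); split=> // j _.
apply/forall_inP => u; rewrite inE /= => /eqP Eu; apply/forall_inP => v; rewrite inE => /eqP Ev.
by apply/implyP => ne; apply: cl_h; rewrite ?inE // Eu.
Qed.

Lemma rl_graph1 l : rl_graph e 1 l <-> exists2 S, independent e S & clique_cover l S.
Proof.
split=> [[f pf]|[S iS [h [lt_h cl_h]]]].
  exists [set u | f u < 1]; last exact: partition_clique_cover.
  have := pf.1 0 isT; congr independent; apply/setP => u; rewrite !inE.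
  by rewrite ltnS leqn0.
have lt u : (if u \in S then 0 else (h u).+1) < 1 + l.
  by case: ifP => // /negbT/lt_h; rewrite add1n ltnS.
exists (fun u => Ordinal (lt u)); split=> [[|//] _|j _].
  by rewrite (_ : part _ 0 = S) //; apply/setP => u; rewrite inE /=; case: ifP.
apply/forall_inP => u; rewrite inE /= add1n; case: ifP => // /negbT uS /eqP[Eu].
apply/forall_inP => v; rewrite inE /=; case: ifP => // /negbT vS /eqP[Ev].
by apply/implyP => ne; apply: cl_h; rewrite // Eu.
Qed.

Lemma greedy_mis N : n <= N -> mis_test n g (greedy n g N).
Proof.
move=> le_nN; have gsym u v : u < n -> v < n -> g u v = g v u.
  by move=> lt_u lt_v; rewrite (ge (Ordinal lt_u) (Ordinal lt_v)) (ge (Ordinal lt_v) (Ordinal lt_u)).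
have girr u : u < n -> g u u = false by move=> lt_u; rewrite (ge (Ordinal lt_u) (Ordinal lt_u)).
(* After [k] rounds the set is maximal independent among the first [k] vertices. *)
have inv k i : i < n -> greedy n g k i =
    (i < k) && ~~ has (fun v => greedy n g k v && g i v) (iota 0 n).
  elim: k i => // k IH i lt_i.
  have E j : greedy n g k.+1 j = greedy n g k j || ((j < n) && ((j == k) &&
      ~~ has (fun v => greedy n g k v && g j v) (iota 0 n))).
    by rewrite /greedy -addn1 iotaD foldl_cat /= add0n.
  rewrite E lt_i /= ltnS leq_eqVlt.
  have [Ei|ne] := eqVneq i k.
    have lt_k : k < n by rewrite -Ei.
    rewrite Ei.
    rewrite IH // ltnn /=.
    congr (~~ _); apply: eq_in_has => v; rewrite mem_iota add0n /= => lt_v; rewrite E lt_v.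
    by have [->|] := eqVneq v k; rewrite ?girr ?andbF ?orbF.
  rewrite /= orbF IH //; case: ltnP => //= lt_ik; congr (~~ _).
  apply/hasP/hasP => -[v]; rewrite mem_iota add0n /= => lt_v.
    by move=> /andP[Av iv]; exists v; rewrite ?mem_iota // E Av.
  rewrite E lt_v; case Av: (greedy n g k v) => /=.
    by move=> iv; exists v; rewrite ?mem_iota // Av.
  (* The neighbour of [i] is the vertex [k] just added. Then [i] was not chosen, since [k] had no
     chosen neighbour; so [i] already had one itself. *)
  case/andP => /andP[/eqP Ev]; rewrite {}Ev {v Av} in lt_v * => Nk ik.
  have := IH i lt_i; rewrite lt_ik /=; case Ai: (greedy n g k i); last first.
    by move/esym/negbFE/hasP.
  by case/negP: Nk; apply/hasP; exists i; rewrite ?mem_iota // Ai gsym.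
apply/allP => u; rewrite mem_iota => lt_u; by rewrite inv // (leq_trans _ le_nN).
Qed.

End Graph.

(** * Correctness: recognition *)

Lemma all_smallPn n l (Phi : pred (nat -> bool)) A : ~~ all_small n l Phi A ->
  exists s, ~~ Phi (foldl add_elt A s).
Proof.
elim: l A => [|l IH] A /=; first by rewrite andbT => ?; exists [::].
rewrite negb_and => /orP[NA|/allPn[y _ /IH[s Hs]]]; first by exists [::].
by exists (y :: s).
Qed.

(** * Bipartiteness and odd closed walks *)

Section Bipartite.

Variables (n N : nat) (R : nat -> nat -> bool).
Hypotheses (le_nN : n <= N) (R_sym : forall u v : 'I_n, R u v = R v u).

Let r1 : rel 'I_n := fun u v => R u v.
Let r2 : rel 'I_n := fun z x => [exists y : 'I_n, R z y && R y x].

Lemma even_walksS k u (x : 'I_n) : even_walks n R k.+1 u x =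
  even_walks n R k u x || [exists z : 'I_n, even_walks n R k u z && r2 z x].
Proof.
rewrite /even_walks -addn1 iotaD foldl_cat /= ltn_ord /=; congr (_ || _).
by rewrite has_iota_ord; apply: eq_existsb => z; rewrite has_iota_ord.
Qed.

Lemma even_walksE (u x : 'I_n) : even_walks n R N u x = connect r2 u x.
Proof.
apply/idP/idP => [|/connectP[p0 p0P ->]].
  elim: N x => [|k IH] x; first by rewrite /even_walks /= => /eqP/val_inj->.
  rewrite even_walksS => /orP[/IH//|/existsP[z /andP[/IH uz zx]]].
  by apply: connect_trans uz (connect1 zx).
(* A path without repetition has fewer than [n] steps, so [N >= n] rounds reach everything. *)
case: (shortenP p0P) => p pP Up _.
have: size p <= N.
  apply: leq_trans le_nN; apply: ltnW.
  by have := max_card [in u :: p]; rewrite card_ord (card_uniqP Up).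
elim: N p pP {Up} => [|k IH] p.
  by case: p => // _ _; rewrite /even_walks /= eqxx.
case/lastP: p => [_ _|p y].
  by rewrite even_walksS IH.
rewrite rcons_path size_rcons last_rcons ltnS => /andP[pP py] le_p.
rewrite even_walksS; apply/orP; right; apply/existsP; exists (last u p).
by rewrite py IH.
Qed.

Lemma bipartite_testP : bipartite_test n R N <->
  exists h : 'I_n -> bool, forall u v : 'I_n, R u v -> h u != h v.
Proof.
rewrite /bipartite_test all_iota_ord; split=> [/forallP H|[h Hh]].
  have noodd (u x : 'I_n) : connect r2 u x -> R x u = false.
    move=> ux; apply/negbTE/negP => xu; have := H u; rewrite has_iota_ord => /existsPn/(_ x).
    by rewrite even_walksE ux xu.
  have sym1 : connect_sym r1 by apply: sym_connect_sym => u v; apply: R_sym.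
  have sym2 : connect_sym r2.
    apply: sym_connect_sym => u v; apply: eq_existsb => y.
    by rewrite andbC (R_sym u) (R_sym v).
  have walk r u : connect r1 r u ->
      connect r2 r u \/ exists2 z, connect r2 r z & R (val z) (val u).
    case/connectP => p; elim/last_ind: p u => [|p x IH] u; first by move=> _ ->; left.
    rewrite rcons_path last_rcons => /andP[pP px] ->.
    case: (IH _ pP erefl) => [c|[z c zp]]; first by right; exists (last r p).
    by left; apply: connect_trans c (connect1 _); apply/existsP; exists (last r p); rewrite zp.
  (* A vertex is coloured by whether an even walk joins it to the root [r] of its component. If
     adjacent [u], [v] had equal colours, both would have even walks to [r], as an odd walk to [u]
     extends to an even one to [v]; with the edge [uv] they form a closed odd walk. *)
  exists (fun x => connect r2 (root r1 x) x) => u v uv.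
  have Er : root r1 v = root r1 u by apply/esym/(rootP sym1); apply: connect1.
  rewrite Er; set r := root r1 u.
  have rv : connect r1 r v by rewrite /r -Er sym1 connect_root.
  have ru : connect r1 r u by rewrite sym1 connect_root.
  apply/eqP => E; have cv : connect r2 r v.
    case: (walk r u ru) => [|[z cz zu]]; first by rewrite E.
    by apply: connect_trans cz (connect1 _); apply/existsP; exists u; rewrite zu.
  have cu : connect r2 u r by rewrite sym2 E.
  by have := noodd _ _ (connect_trans cu cv); rewrite R_sym uv.
apply/forallP => u; rewrite has_iota_ord; apply/existsPn => x.
rewrite even_walksE; apply/negP => /andP[/connectP[p pP Ex] /Hh].
suff -> : h x = h u by rewrite eqxx.
rewrite {}Ex; elim: p u pP => //= y p IH u /andP[/existsP[z /andP[/Hh uz /Hh zy]]] /IH ->.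
by case: (h u) (h z) (h y) uz zy => [] [] [].
Qed.

End Bipartite.

Section Recognition.

Variables (n : nat) (e : 'I_n -> 'I_n -> bool) (g : nat -> nat -> bool) (N : nat).
Hypotheses (simple_e : simple_graph e) (ge : forall u v : 'I_n, g u v = e u v).
Hypothesis le_nN : n <= N.

Lemma cliques_testP l S : l <= 2 ->
  cliques_test n g N l S <-> clique_cover e l (vertex_set n S).
Proof.
have e_sym u v : e u v = e v u by case: simple_e.
case: l => [|[|[|//]]] _ /=.
- rewrite all_iota_ord; split=> [/forallP H|[h [lt_h _]]].
    by exists (fun=> 0); split=> [u|u v]; rewrite inE H.
  by apply/forallP => u; apply/negPn/negP => Nu; have := lt_h u; rewrite inE => /(_ Nu).
- rewrite all_iota_ord; split=> [/forallP H|[h [lt_h cl_h]]].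
    exists (fun=> 0); split=> // u v; rewrite !inE => Nu Nv ne _.
    have := H u; rewrite all_iota_ord => /forallP/(_ v).
    by rewrite (negPf Nu) (negPf Nv) (inj_eq val_inj) (negPf ne) ge.
  apply/forallP => u; rewrite all_iota_ord; apply/forallP => v.
  case: (boolP (S u)) => //= Nu; case: (boolP (S v)) => //= Nv.
  have [//|ne] := eqVneq (val u) v; rewrite ge; apply: cl_h; rewrite ?inE //.
  have := lt_h u; have := lt_h v; rewrite !inE => /(_ Nv) + /(_ Nu).
  by case: (h u) (h v) => [|//] [].
set R := fun u v => _.
have R_sym (u v : 'I_n) : R u v = R v u.
  by rewrite /R !ge e_sym eq_sym; case: (S u) (S v) => [] [].
rewrite bipartite_testP //; split=> [[h Hh]|[h [lt_h cl_h]]].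
  exists (fun u => nat_of_bool (h u)); split=> [u _|u v]; first by case: (h u).
  rewrite !inE => Nu Nv ne E; apply/negPn/negP => Nuv.
  have := Hh u v; rewrite /R Nu Nv ge Nuv (inj_eq val_inj) ne => /(_ isT).
  by case: (h u) (h v) E => [] [].
exists (fun u => h u == 0) => u v /and4P[Nu Nv ne]; rewrite ge => Nuv.
have := lt_h u; have := lt_h v; have := cl_h u v; rewrite !inE => cl /(_ Nv) + /(_ Nu).
case: (h u) (h v) cl => [|[|//]] [|[|//]] // cl _ _.
  by case/negP: Nuv; apply: cl.
by case/negP: Nuv; apply: cl.
Qed.

(** The clique cover found by the first conjunct supplies the bound that makes [wc_test] exact. *)
Lemma split_testP l S : l <= 2 -> independent e (vertex_set n S) ->
  split_test n g N l S <-> clique_cover e l (vertex_set n S) /\ well_covered e.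
Proof.
move=> le_l iS; have wcP := wc_testP simple_e ge iS (l := l).
split=> [/andP[/(cliques_testP S le_l) cl]|[cl]].
  by rewrite wcP // => T; apply: clique_cover_bound.
move=> wc; apply/andP; split; first exact/cliques_testP.
by rewrite wcP // => T; apply: clique_cover_bound.
Qed.

Lemma rec0_testP l : l <= 2 -> split_test n g N l empty_set <-> rl_well_covered e 0 l.
Proof.
move=> le_l; have E0 : vertex_set n empty_set = set0 by apply/setP => u; rewrite !inE.
rewrite split_testP // E0 /rl_well_covered ?rl_graph0 //.
by apply/independentP => u v; rewrite inE.
Qed.

Lemma indep_testE S : indep_test n g S = independent e (vertex_set n S).
Proof.
rewrite /indep_test all_iota_ord; apply/forallP/independentP => [H u v|H u].
  rewrite !inE => Su Sv; have := H u; rewrite all_iota_ord => /forallP/(_ v).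
  by rewrite Su Sv ge /= => /negbTE.
rewrite all_iota_ord; apply/forallP => v; have := H u v; rewrite !inE ge.
by case: (S u) (S v) => [] [] // ->.
Qed.

Lemma rec1_testP l : l <= 2 -> rec1_test n g N l <-> rl_well_covered e 1 l.
Proof.
move=> le_l; split=> [|[/rl_graph1 [S0 iS0 cl0] wc]].
  move=> /all_smallPn[s1 /all_smallPn[s2]]; rewrite negbK /= indep_testE => /andP[iS].
  move/(split_testP le_l iS) => [cl wc]; split=> //.
  by apply/rl_graph1; eexists; first exact: iS.
set I := vertex_set n (greedy n g N).
have mI : maximal_independent e I by rewrite -(mis_testE simple_e ge) (greedy_mis simple_e ge).
(* Enlarging the independent part to a maximal one keeps the clique cover. *)
have [S mS sub] := extend_independent iS0.
have clS : clique_cover e l S.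
  have [h [lt_h cl_h]] := cl0; exists h; split=> [u uS|u v uS vS].
    by apply: lt_h; apply: contra uS; apply: (subsetP sub).
  by apply: cl_h; [apply: contra uS | apply: contra vS]; apply: (subsetP sub).
have leX : #|I :\: S| <= l by apply: clique_cover_bound clS (maximal_indep mI).
(* Well-coveredness gives [#|S| = #|I|], so both differences have the same size. *)
have leY : #|S :\: I| <= l.
  by have := cardsID I S; have := cardsID S I; rewrite (wc _ _ mI mS) setIC; lia.
have [sX [le1 lt1 E1]] := small_set_seq leX.
have [sY [le2 lt2 E2]] := small_set_seq leY.
apply/negP => /all_smallP/(_ sX le1 lt1)/all_smallP/(_ sY le2 lt2)/negP; apply.
set T := swap _ _ _; have ET : vertex_set n T = S.
  apply/setP => u; rewrite inE /T /swap E1 E2 !inE.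
  by case: (greedy n g N u) (u \in S) => [] [].
have iT : independent e (vertex_set n T) by rewrite ET (maximal_indep mS).
by rewrite indep_testE iT; apply/(split_testP le_l iT); rewrite ET.
Qed.

Lemma rl_graph2 : rl_graph e 2 0 <->
  exists h : 'I_n -> bool, forall u v, e u v -> h u != h v.
Proof.
split=> [[f [indf _]]|[h Hh]].
  exists (fun u => val (f u) == 0) => u v uv; apply/negP => /eqP E.
  have lt i : i < 2 -> (val (f u) == i) && (val (f v) == i) = false.
    move=> /indf/independentP/(_ u v); rewrite !inE => H; apply/negP => /andP[Eu Ev].
    by rewrite H in uv.
  move: E (lt 0 isT) (lt 1 isT) => /=; case: (f u) (f v) => [a lt_a] [b lt_b] /=.
  by move: lt_a lt_b; case: a b => [|[|//]] [|[|//]].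
have lt u : nat_of_bool (h u) < 2 + 0 by case: (h u).
exists (fun u => Ordinal (lt u)); split=> // i _; apply/independentP => u v.
rewrite !inE /= => /eqP Eu /eqP Ev; apply/negbTE/negP => /Hh.
by case: (h u) (h v) Eu Ev => [] [] // <-.
Qed.

Lemma bipartite_rl_graph : bipartite_test n g N <-> rl_graph e 2 0.
Proof.
have e_sym u v : e u v = e v u by case: simple_e.
rewrite bipartite_testP // => [|u v]; last by rewrite !ge.
rewrite rl_graph2; split=> -[h Hh]; exists h => u v; [rewrite -ge|rewrite ge]; exact: Hh.
Qed.

End Recognition.

(** * Correctness: bipartite graphs *)

Section GoodEdges.

Variables (n : nat) (e : 'I_n -> 'I_n -> bool).
Hypothesis simple_e : simple_graph e.

Let e_sym u v : e u v = e v u. Proof. by case: simple_e. Qed.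

Definition nbrs (u : 'I_n) : {set 'I_n} := [set v | e u v].

Definition good (x y : 'I_n) : bool :=
  e x y && [forall a, forall b, e x b ==> e y a ==> e a b].

Definition partners (x : 'I_n) : {set 'I_n} := [set y | good x y].

Lemma goodP x y :
  reflect (e x y /\ forall a b, e x b -> e y a -> e a b) (good x y).
Proof.
apply: (iffP andP) => [[xy /forallP H]|[xy H]]; split=> //.
  by move=> a b xb ya; have /forallP/(_ b) := H a; rewrite xb ya.
by apply/forallP => a; apply/forallP => b; apply/implyP => xb; apply/implyP; apply: H.
Qed.

Lemma good_sym x y : good x y = good y x.
Proof.
suff imp u v : good u v -> good v u by apply/idP/idP; apply: imp.
by move=> /goodP[uv H]; apply/goodP; split=> [|a b va ub]; rewrite e_sym //; apply: H.
Qed.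

Definition good_cond : Prop := forall x, nbrs x != set0 ->
  partners x != set0 /\ forall y, good x y -> #|partners x| = #|partners y|.

(** * The condition on good edges implies well-coveredness *)

Section Sufficient.

Hypothesis cond : good_cond.

Lemma good_nbrs x y : good x y -> nbrs x != set0.
Proof. by case/goodP => xy _; apply/set0Pn; exists y; rewrite inE. Qed.

(* Give the good edges at [x] the weight [1 / #|partners x|], scaled by [n!]:
   each has exactly one end in [T], and both ends give it the same weight. *)
Lemma maximal_independent_half T : maximal_independent e T ->
  #|T :&: [set x | nbrs x != set0]| = #|~: T :&: [set x | nbrs x != set0]|.
Proof.
move=> /(maximal_independentP simple_e) mT.
(* If neither end were in [T], maximality would give neighbours [b] of [x] and [a] of [y] in [T],
   adjacent because the edge is good. *)
have excl x y : good x y -> (x \in T) = (y \notin T).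
  move=> /goodP[xy H]; apply/idP/idP => [|yT].
    by rewrite mT => /existsPn/(_ y); rewrite xy andbT.
  apply/negPn/negP => xT; move: xT yT; rewrite !mT !negbK => /existsP[b /andP[bT xb]].
  case/existsP => a /andP[aT ya]; have := H a b xb ya; move: aT.
  by rewrite mT => /existsPn/(_ b); rewrite bT => /negP.
pose w x := n`! %/ #|partners x|.
have sumw x : \sum_(y | good x y) w x = (nbrs x != set0) * n`!.
  case: (boolP (nbrs x != set0)) => [nx|iso].
    have [ne _] := cond nx; rewrite sum_nat_const -cardsE -/(partners x) mul1n mulnC divnK //.
    by rewrite dvdn_fact // card_gt0 ne (leq_trans (max_card _)) ?card_ord.
  by rewrite big1 // => y /good_nbrs; rewrite (negPf iso).
have cnt (S : {set 'I_n}) : \sum_(x in S) \sum_(y | good x y) w x =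
    #|S :&: [set x | nbrs x != set0]| * n`!.
  rewrite (eq_bigr _ (fun x _ => sumw x)) -big_distrl /=; congr (_ * _).
  by rewrite -sum1_card big_mkcond [RHS]big_mkcond; apply: eq_bigr => x _; rewrite !inE; case: (x \in S).
apply/eqP; rewrite -(eqn_pmul2r (fact_gt0 n)) -!cnt; apply/eqP.
(* Double counting: the weights given by the ends in [T] are collected at the opposite ends [y],
   which lie outside [T] and give the same weights. *)
rewrite (exchange_big_dep predT) //= [RHS]big_mkcond; apply: eq_bigr => y _.
rewrite inE; case: (boolP (y \in T)) => yT /=.
  by apply: big1 => x /andP[xT /excl]; rewrite xT yT.
rewrite (eq_bigl (good y)) => [|x].
  apply: eq_bigr => x /[dup] gyx; rewrite good_sym => gxy; rewrite /w.
  by have [_ /(_ y gxy) ->] := cond (good_nbrs gxy).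
by rewrite good_sym; case: (boolP (good y x)); rewrite ?andbF // good_sym => /excl ->; rewrite yT.
Qed.

(** Every maximal independent set contains all isolated vertices and exactly half of the others. *)
Lemma good_cond_well_covered : well_covered e.
Proof.
pose NI := [set x | nbrs x != set0].
have iso T : maximal_independent e T -> T :\: NI = ~: NI.
  move=> /(maximal_independentP simple_e) mT; apply/setP => x; rewrite !inE andbC.
  case: eqP => [ix|]; rewrite ?andbF //= andbT mT; apply/existsPn => v.
  by have /setP/(_ v) := ix; rewrite !inE => ->; rewrite andbF.
move=> T1 T2 m1 m2; rewrite -(cardsID NI T1) -(cardsID NI T2) !iso //; congr (_ + _).
have half T : maximal_independent e T -> (#|T :&: NI|).*2 = #|NI|.
  move=> mT; rewrite -addnn {1}(maximal_independent_half mT) -(cardsID T NI) addnC.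
  by rewrite setDE ![_ :&: NI]setIC.
by apply: double_inj; rewrite !half.
Qed.

End Sufficient.

(** * Well-covered bipartite graphs satisfy the condition *)

Section Necessary.

Variables (h : 'I_n -> bool) (c : bool).
Hypotheses (Hh : forall u v, e u v -> h u != h v) (wc : well_covered e).

(** [B] is one side of the bipartition without isolated vertices, [NN W] the neighbourhood of [W],
    and [cl] a closure operator: [cl W] is the largest subset of [B] whose neighbourhood lies in
    [NN W]. *)
Let B : {set 'I_n} := [set u | (h u == c) && (nbrs u != set0)].
Let NN (W : {set 'I_n}) : {set 'I_n} := [set a | [exists b, (b \in W) && e a b]].
Let cl (W : {set 'I_n}) : {set 'I_n} := [set u in B | nbrs u \subset NN W].

Implicit Types W : {set 'I_n}.

Lemma mem_NN W a b : b \in W -> e a b -> a \in NN W.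
Proof. by move=> bW ab; rewrite inE; apply/existsP; exists b; rewrite bW. Qed.

Lemma NNS W1 W2 : W1 \subset W2 -> NN W1 \subset NN W2.
Proof.
move=> /subsetP S; apply/subsetP => a; rewrite inE => /existsP[b /andP[/S]].
exact: mem_NN.
Qed.

Lemma NNU W1 W2 : NN (W1 :|: W2) = NN W1 :|: NN W2.
Proof.
apply/eqP; rewrite eqEsubset; apply/andP; split; last first.
  by rewrite subUset; apply/andP; split; apply: NNS; rewrite (subsetUl, subsetUr).
apply/subsetP => a; rewrite inE => /existsP[b /andP[/setUP[]bW ab]]; rewrite inE.
  by rewrite (mem_NN bW ab).
by rewrite (mem_NN bW ab) orbT.
Qed.

Lemma NN1 y : NN [set y] = nbrs y.
Proof.
apply/setP => a; rewrite !inE; apply/existsP/idP => [[b]|ya].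
  by rewrite inE e_sym => /andP[/eqP->].
by exists y; rewrite inE eqxx e_sym.
Qed.

Lemma sub_cl W : W \subset B -> W \subset cl W.
Proof.
move=> /subsetP WB; apply/subsetP => b bW; rewrite inE WB //=.
by apply/subsetP => a; rewrite inE e_sym; apply: mem_NN.
Qed.

Lemma NN_cl W : W \subset B -> NN (cl W) = NN W.
Proof.
move=> WB; apply/eqP; rewrite eqEsubset (NNS (sub_cl WB)) andbT.
apply/subsetP => a; rewrite inE => /existsP[b /andP[]]; rewrite inE => /andP[_ /subsetP S] ab.
by apply: S; rewrite inE e_sym.
Qed.

(* For W closed (W = cl W), the set W + {isolated b} + (A \ N(W)), where A is the
   other side, is maximal independent; compare its size with the case W = 0. *)
Lemma card_cl W : W \subset B -> #|cl W| = #|NN W|.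
Proof.
pose Z := [set u | (h u == c) && (nbrs u == set0)].
pose A := [set u | h u != c].
pose T W := [set u | if h u == c then nbrs u \subset NN W else u \notin NN W].
have mT W' : W' \subset B -> maximal_independent e (T W').
  move=> WB; apply/(maximal_independentP simple_e) => u; rewrite inE.
  case: eqP => [hu|/eqP hu].
    apply/subsetP/existsPn => [S v|H v].
      apply/negP => /andP[vT uv]; have vN : v \in NN W' by apply: S; rewrite inE.
      by move: vT; rewrite inE -hu eq_sym (negPf (Hh uv)) vN.
    rewrite inE => uv; apply/negPn/negP => vN; have := H v.
    by rewrite uv andbT inE -hu eq_sym (negPf (Hh uv)) vN.
  congr (~~ _); apply/idP/existsP => [|[b /andP[bT ub]]].
    rewrite inE => /existsP[b /andP[bW ub]]; exists b; rewrite ub andbT.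
    have := subsetP WB b bW; rewrite !inE => /andP[-> _].
    by apply/subsetP => a; rewrite inE e_sym; apply: mem_NN.
  have hb : h b == c by move: hu (Hh ub); case: (h u) (h b) (c) => [] [] [].
  by move: bT; rewrite inE hb => /subsetP; apply; rewrite inE e_sym.
have NNA W' : W' \subset B -> NN W' \subset A.
  move=> /subsetP WB; apply/subsetP => a; rewrite !inE => /existsP[b /andP[/WB]].
  by rewrite inE => /andP[/eqP <- _]; apply: Hh.
(* [T W'] is the disjoint union of [cl W'], the isolated vertices [Z] of its side and
   [A :\: NN W']. *)
have szT W' : W' \subset B -> #|T W'| + #|NN W'| = #|cl W'| + (#|Z| + #|A|).
  move=> WB; rewrite -(cardsID A (T W')) -(cardsID Z (T W' :\: A)) -(cardsID (NN W') A).
  have -> : T W' :&: A = A :\: NN W'.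
    by apply/setP => u; rewrite !inE; case: (h u == c); rewrite ?andbF ?andbT.
  have -> : A :&: NN W' = NN W' by apply/setIidPr; apply: NNA.
  have -> : (T W' :\: A) :&: Z = Z.
    apply/setIidPr/subsetP => u; rewrite !inE => /andP[hu /eqP ->].
    by rewrite hu sub0set.
  have -> : (T W' :\: A) :\: Z = cl W'.
    by apply/setP => u; rewrite !inE; case: (h u == c); rewrite //= andbT.
  by move: #|_ :\: _| #|Z| #|cl W'| #|NN W'| => p q r s; clear; lia.
have cl0 : cl set0 = set0.
  apply/setP => u; rewrite !inE; apply/negP => /andP[/andP[_ /set0Pn[v uv]] /subsetP/(_ v uv)].
  by rewrite inE => /existsP[b]; rewrite inE.
have NN0 : NN set0 = set0.
  by apply/setP => a; rewrite !inE; apply/existsP => -[b]; rewrite inE.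
move=> WB; have := szT W WB; have := szT set0 (sub0set _); rewrite cl0 NN0 !cards0.
rewrite (wc (mT W WB) (mT set0 (sub0set _))) addn0 add0n => -> E.
by apply: (@addIn (#|Z| + #|A|)); rewrite -E addnC.
Qed.

(** The sets attaining equality in Hall's condition, which [card_le_NN] establishes. *)
Definition tight W : bool := (W \subset B) && (#|W| == #|NN W|).

Lemma card_le_NN W : W \subset B -> #|W| <= #|NN W|.
Proof. by move=> WB; rewrite -(card_cl WB) subset_leq_card ?sub_cl. Qed.

Lemma cl_sub W : cl W \subset B.
Proof. by apply/subsetP => u /setIdP[]. Qed.

Lemma tight_cl W : W \subset B -> tight (cl W).
Proof. by move=> WB; rewrite /tight cl_sub card_cl // NN_cl ?eqxx. Qed.

(* |N(W)| is submodular and at least |W|. *)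
Lemma tightU W1 W2 : tight W1 -> tight W2 ->
  tight (W1 :|: W2) /\ NN (W1 :&: W2) = NN W1 :&: NN W2.
Proof.
move=> /andP[B1 /eqP t1] /andP[B2 /eqP t2].
have BU : W1 :|: W2 \subset B by rewrite subUset B1.
have BI : W1 :&: W2 \subset B by apply: subset_trans (subsetIl _ _) B1.
have sub : NN (W1 :&: W2) \subset NN W1 :&: NN W2.
  by rewrite subsetI !NNS ?subsetIl ?subsetIr.
have := card_le_NN BU; have := card_le_NN BI; have := subset_leq_card sub.
have := cardsUI W1 W2; have := cardsUI (NN W1) (NN W2); rewrite NNU => *.
split; first by rewrite /tight BU NNU; apply/eqP; lia.
by apply/eqP; rewrite eqEcard sub; lia.
Qed.

Section Vertex.

Variable y : 'I_n.
Hypothesis yB : y \in B.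

Let below : {set 'I_n} := [set b in B | nbrs b \proper nbrs y].

Let y1B : [set y] \subset B. Proof. by rewrite sub1set. Qed.

(** [below] is the union of the closures of its elements; closures are tight, and so are unions of
    tight sets. *)
Lemma tight_below : tight below.
Proof.
have -> : below = \bigcup_(b in below) cl [set b].
  apply/setP => b; apply/idP/bigcupP => [bb|[b' b'b]].
    by exists b => //; move: bb; rewrite !inE => /andP[-> _]; rewrite NN1 /=.
  rewrite inE NN1 => /andP[bB sub]; move: b'b; rewrite !inE => /andP[_ pr].
  by move: bB; rewrite inE => -> /=; apply: sub_proper_trans pr.
apply: (big_ind tight) => [|W1 W2 t1 t2|b]; last by rewrite inE => /andP[bB _]; apply: tight_cl; rewrite sub1set.
  rewrite /tight sub0set cards0 eq_sym cards_eq0; apply/eqP/setP => a.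
  by rewrite !inE; apply/existsP => -[b]; rewrite inE.
by have [] := tightU t1 t2.
Qed.

(** If [a], [b] witness that the edge is not good, the vertices of [B] not adjacent to [a] form a
    tight set. Intersecting it with [cl [set y]] yields a neighbour of [x] in [below]. *)
Lemma good_private x : e x y -> x \notin NN below -> good x y.
Proof.
move=> xy xN; apply/goodP; split=> // a b xb ya; apply/negPn/negP => ab.
(* [Wa] is closed, since [a] is not in [N(Wa)], whereas [x] is, through [b]. *)
pose Wa := [set b in B | ~~ e a b].
have Wa_cl : cl Wa = Wa.
  apply/eqP; rewrite eqEsubset sub_cl ?andbT; last by apply/subsetP => u /setIdP[].
  apply/subsetP => b' /setIdP[bB /subsetP S]; rewrite inE bB /=; apply/negP => ab'.
  have := S a; rewrite !inE e_sym => /(_ ab') /existsP[b'' /andP[]].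
  by rewrite inE => /andP[_ /negPf->].
have tWa : tight Wa by rewrite -Wa_cl tight_cl //; apply/subsetP => u /setIdP[].
have [_ NI] := tightU tWa (tight_cl y1B).
have bWa : b \in Wa.
  rewrite !inE ab andbT; apply/andP; split; last by apply/set0Pn; exists x; rewrite inE e_sym.
  move: yB; rewrite inE => /andP[/eqP <- _].
  by move: (Hh xy) (Hh xb); case: (h x) (h y) (h b) => [] [] [].
(* For tight sets the neighbourhood of the intersection is the intersection of the neighbourhoods,
   and [x] lies in both. *)
have: x \in NN (Wa :&: cl [set y]).
  by rewrite NI NN_cl // NN1 inE (mem_NN bWa xb) inE e_sym.
rewrite inE => /existsP[b' /andP[/setIP[b'Wa /setIdP[b'B sub]] xb']].
case/negP: xN; apply: mem_NN xb'; rewrite inE b'B properE -(NN1 y) sub /=.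
apply/subsetPn; exists a; first by rewrite NN1 inE.
by move: b'Wa; rewrite !inE e_sym => /andP[].
Qed.

(** A neighbour [b] of [x] in [below] misses some neighbour [a] of [y], so [xy] is not good; the
    converse is [good_private]. *)
Lemma partnersE : partners y = nbrs y :\: NN below.
Proof.
apply/setP => x; rewrite in_setD [x \in partners y]inE [x \in nbrs y]inE.
apply/idP/andP => [gyx|[xN yx]]; last by rewrite good_sym good_private // e_sym.
have /goodP[yx H] := gyx; split=> //; apply/negP; rewrite inE => /existsP[b /andP[]].
rewrite inE properE => /andP[_ /andP[_ /subsetPn[a]]]; rewrite !inE => ya ba xb.
by move: ba; rewrite e_sym (_ : e a b) // e_sym; apply: H.
Qed.

Let twins : {set 'I_n} := cl [set y] :\: below.

Lemma sub_below : below \subset cl [set y].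
Proof.
by apply/subsetP => b /setIdP[bB /proper_sub]; rewrite inE bB NN1.
Qed.

Lemma twinsE b : (b \in twins) = (b \in B) && (nbrs b == nbrs y).
Proof.
rewrite in_setD [b \in below]inE [b \in cl _]inE NN1 properE eqEsubset.
by case: (b \in B) (nbrs b \subset nbrs y) => [] [] //=; rewrite ?negbK ?andbT.
Qed.

(** Subtract [#|NN below| = #|below|] from [#|nbrs y| = #|cl [set y]|]. *)
Lemma card_partners : #|partners y| = #|twins|.
Proof.
have Ey : #|nbrs y| = #|cl [set y]| by rewrite card_cl // NN1.
rewrite partnersE /twins !cardsD Ey (setIidPr sub_below).
have -> : nbrs y :&: NN below = NN below.
  by apply/setIidPr; rewrite -NN1 -(NN_cl y1B) NNS ?sub_below.
by have /andP[_ /eqP->] := tight_below.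
Qed.

Lemma partners_neq0 : partners y != set0.
Proof.
by rewrite -card_gt0 card_partners card_gt0; apply/set0Pn; exists y; rewrite twinsE yB eqxx.
Qed.

(** If [xy] and [xb] are both good, each of [nbrs y] and [nbrs b] contains the other. With
    [card_partners] this equates the numbers of good edges at [x] and at [y]. *)
Lemma partners_twins x : good y x -> partners x = twins.
Proof.
move=> gyx; have /goodP[yx H] := gyx; apply/setP => b; rewrite twinsE inE.
apply/goodP/andP => [[xb Hb]|[bB /eqP nb]].
  split.
    rewrite !inE; apply/andP; split; last by apply/set0Pn; exists x; rewrite inE e_sym.
    move: yB; rewrite inE => /andP[/eqP <- _].
    by move: (Hh yx) (Hh xb); case: (h x) (h y) (h b) => [] [] [].
  rewrite eqEsubset; apply/andP; split; apply/subsetP => a; rewrite !inE => ?.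
    by rewrite e_sym; apply: Hb => //; rewrite e_sym.
  exact: H.
have nE a : e b a = e y a by have /setP/(_ a) := nb; rewrite !inE.
split=> [|a b' xb' ba]; first by rewrite e_sym nE.
by rewrite nE in ba; rewrite e_sym; apply: H.
Qed.

End Vertex.


End Necessary.

Lemma well_covered_good_cond (h : 'I_n -> bool) :
  (forall u v, e u v -> h u != h v) -> well_covered e -> good_cond.
Proof.
(* The side [c] is taken to be the one of [x], so both sides are covered. *)
move=> Hh wc x nx; have xB c : h x = c -> x \in [set u | (h u == c) && (nbrs u != set0)].
  by rewrite inE => /eqP->.
split=> [|y gxy]; first exact: (partners_neq0 Hh wc (xB _ erefl)).
by rewrite (card_partners Hh wc (xB _ erefl)) (partners_twins Hh (xB _ erefl) gxy).
Qed.

Variable g : nat -> nat -> bool.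
Hypothesis ge : forall u v : 'I_n, g u v = e u v.

Lemma good_edgeE x y : good_edge n g (val x) (val y) = good x y.
Proof.
rewrite /good_edge ge all_iota_ord; congr (_ && _); apply: eq_forallb => a.
by rewrite all_iota_ord; apply: eq_forallb => b; rewrite !ge.
Qed.

Lemma wc_bip_testP (h : 'I_n -> bool) : (forall u v, e u v -> h u != h v) ->
  wc_bip_test n g <-> well_covered e.
Proof.
move=> Hh; suff -> : wc_bip_test n g <-> good_cond.
  by split=> [|wc]; [exact: good_cond_well_covered | exact: well_covered_good_cond Hh wc].
have cntE x : count (good_edge n g (val x)) (iota 0 n) = #|partners x|.
  by rewrite count_iota_ord; apply: eq_card => y; rewrite !inE good_edgeE.
have neE x : has (g (val x)) (iota 0 n) = (nbrs x != set0).
  by rewrite has_iota_ord; apply/existsP/set0Pn => -[v Hv]; exists v; move: Hv; rewrite inE ge.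
have peE x : has (good_edge n g (val x)) (iota 0 n) = (partners x != set0).
  by rewrite has_iota_ord; apply/existsP/set0Pn => -[v Hv]; exists v; move: Hv; rewrite inE good_edgeE.
rewrite /wc_bip_test all_iota_ord; split=> [/forallP H x nx|H].
  have := H x; rewrite neE nx /= peE => /andP[-> ]; rewrite all_iota_ord => /forallP Hy.
  by split=> // y gxy; have := Hy y; rewrite good_edgeE gxy !cntE => /eqP.
apply/forallP => x; rewrite neE peE; apply/implyP => /H[-> Hy] /=.
rewrite all_iota_ord; apply/forallP => y; rewrite good_edgeE !cntE.
by apply/implyP => /Hy ->.
Qed.

End GoodEdges.

(** * The problems *)

Lemma well_covered_empty n (adj : 'I_n -> 'I_n -> bool) : n = 0 -> well_covered adj.
Proof.
move=> n0 S T _ _; have card0 (U : {set 'I_n}) : #|U| = 0.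
  by apply/eqP; rewrite -leqn0 -[X in _ <= X]n0 -[X in _ <= X]card_ord max_card.
by rewrite !card0.
Qed.

Lemma rl_graph_empty n (adj : 'I_n -> 'I_n -> bool) r l : n = 0 -> rl_graph adj r l.
Proof.
move=> n0; have F (u : 'I_n) : False by move: u; rewrite n0; case.
exists (fun u => False_rect _ (F u)); split=> j _.
  by apply/forall_inP => u; case: (F u).
by apply/forall_inP => u; case: (F u).
Qed.

(** * Recognition problems *)

Section Recognition.

Variables r l : nat.

Let enc (G : graph_input) := enc_graph (projT2 G).
Let Valid (G : graph_input) := simple_graph (projT2 G).
Let n (G : graph_input) := projT1 G.

Lemma size_enc_graph_input G : Valid G -> size (enc G) = n G * n G + n G * 0.
Proof. by move=> _; rewrite size_enc_graph muln0 addn0. Qed.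

Lemma matrix_bit_graph G (u v : 'I_(n G)) : matrix_bit enc n G u v = projT2 G u v.
Proof. exact: nth_allpairs_ord. Qed.

Lemma rlwcg_of_test (P : graph_input -> bool) : BC (c := input Valid enc) P ->
  (forall G, Valid G -> n G <= size (enc G) -> P G <-> rl_well_covered (projT2 G) r l) ->
  problem_rlwcg r l.
Proof.
move=> HP PQ; apply: (poly_time_BC HP) => G VG.
  by move=> _; apply: PQ => //; rewrite size_enc_graph_input //; nia.
move=> s0; have n0 : n G = 0 by have := size_enc_graph_input VG; rewrite s0; lia.
by split; [apply: rl_graph_empty | apply: well_covered_empty].
Qed.

End Recognition.

Lemma rlwcg0 l : l <= 2 -> problem_rlwcg 0 l.
Proof.
move=> le_l; have vs := vertices_input size_enc_graph_input.
have rc := RC_input size_enc_graph_input.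
apply: rlwcg_of_test (BC_split vs rc l (computable_const _ false)) _ => G VG le_n.
exact: (rec0_testP VG (@matrix_bit_graph G) le_n le_l).
Qed.

Lemma rlwcg1 l : l <= 2 -> problem_rlwcg 1 l.
Proof.
move=> le_l; have vs := vertices_input size_enc_graph_input.
have rc := RC_input size_enc_graph_input.
apply: rlwcg_of_test (BC_rec1 l vs rc) _ => G VG le_n.
exact: (rec1_testP VG (@matrix_bit_graph G) le_n le_l).
Qed.

Lemma rlwcg20 : problem_rlwcg 2 0.
Proof.
have vs := vertices_input size_enc_graph_input.
have rc := RC_input size_enc_graph_input.
apply: rlwcg_of_test (BC_and (BC_bipartite vs rc) (BC_wc_bip vs rc)) _ => G VG le_n.
have bip := bipartite_rl_graph VG (@matrix_bit_graph G) le_n.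
split=> [/andP[/bip rlG]|[rlG]].
  have [h Hh] := (rl_graph2 (projT2 G)).1 rlG.
  by move/(wc_bip_testP VG (@matrix_bit_graph G) Hh).
have [h Hh] := (rl_graph2 (projT2 G)).1 rlG.
by move/(wc_bip_testP VG (@matrix_bit_graph G) Hh) => ->; rewrite andbT; apply/bip.
Qed.

(** * Problems with a given partition *)

Section Labelled.

Variables r l : nat.

Let enc (G : labelled_input r l) := enc_labelled (projT2 G).1 r l (projT2 G).2.
Let Valid (G : labelled_input r l) :=
  simple_graph (projT2 G).1 /\ is_rl_partition (projT2 G).1 r l (projT2 G).2.
Let n (G : labelled_input r l) := projT1 G.

Lemma size_one_hot k (i : 'I_k) : size [seq i == j | j <- enum 'I_k] = k.
Proof. by rewrite size_map size_enum_ord. Qed.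

Lemma size_enc_labelled G : Valid G -> size (enc G) = n G * n G + n G * (r + l).
Proof.
move=> _; rewrite size_cat size_enc_graph size_flatten /shape -map_comp; congr (_ + _).
rewrite (eq_map (g := fun=> r + l)) => [|v /=]; last by rewrite size_one_hot.
by rewrite sumnE big_map big_const_seq count_predT size_enum_ord iter_addn_0 mulnC.
Qed.

Lemma matrix_bit_labelled G (u v : 'I_(n G)) : matrix_bit enc n G u v = (projT2 G).1 u v.
Proof.
rewrite /matrix_bit nth_cat size_enc_graph ifT ?nth_allpairs_ord //.
by move: (ltn_ord u) (ltn_ord v); rewrite /n; nia.
Qed.

Lemma label_bitE k G (u : 'I_(n G)) : k < r + l ->
  label_bit enc n (r + l) k G u = (val ((projT2 G).2 u) == k).
Proof.
move=> lt_k; rewrite /label_bit nth_cat size_enc_graph ltnNge leq_addr /= addKn.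
rewrite nth_flatten_ord => [|v|//]; last by rewrite size_one_hot.
by rewrite (nth_map (Ordinal lt_k)) ?size_enum_ord // -val_eqE /= nth_enum_ord.
Qed.

Lemma wcrlg_of_test (P : labelled_input r l -> bool) : BC (c := input Valid enc) P ->
  (forall G, Valid G -> P G <-> well_covered (projT2 G).1) -> problem_wcrlg r l.
Proof.
move=> HP PQ; apply: (poly_time_BC HP) => G VG; first by move=> _; apply: PQ.
move=> s0; apply: well_covered_empty.
by have := size_enc_labelled VG; rewrite s0 /n; nia.
Qed.

(** [S] is the union of the [r] independent parts, required to be independent itself: empty for
    [r = 0], the vertices with label 0 for [r = 1]. The remaining labels provide the cliques that
    bound [T :\: S]. *)
Lemma wcrlg_of_sparse (S : labelled_input r l -> nat -> bool) :
  computable (c := input Valid enc) S ->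
  (forall G, Valid G -> independent (projT2 G).1 (vertex_set (n G) (S G))) ->
  (forall G, Valid G -> vertex_set (n G) (S G) = [set u | (projT2 G).2 u < r]) ->
  problem_wcrlg r l.
Proof.
move=> HS iS ES; have vs := vertices_input size_enc_labelled.
have rc := RC_input size_enc_labelled.
apply: wcrlg_of_test (BC_wc vs rc l HS) _ => G VG.
apply: (wc_testP VG.1 (@matrix_bit_labelled G) (iS G VG)) => T.
by apply: clique_cover_bound; rewrite ES //; apply: partition_clique_cover VG.2.
Qed.

End Labelled.

Lemma wcrlg0 l : problem_wcrlg 0 l.
Proof.
apply: (wcrlg_of_sparse (S := fun=> empty_set)) => [|G VG|G VG].
- exact: computable_const.
- by apply/independentP => u v; rewrite inE.
- by apply/setP => u; rewrite !inE.
Qed.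

Lemma wcrlg1 l : problem_wcrlg 1 l.
Proof.
have HS := computable_label (@size_enc_labelled 1 l) (ltn0Sn l : 0 < 1 + l).
apply: (wcrlg_of_sparse HS) => [G VG|G VG].
- have := VG.2.1 0 isT; congr independent; apply/setP => u; rewrite !inE ltn_ord.
  by rewrite label_bitE.
- apply/setP => u; rewrite !inE ltn_ord label_bitE //=.
  by rewrite ltnS leqn0.
Qed.

Lemma wcrlg20 : problem_wcrlg 2 0.
Proof.
have vs := vertices_input (@size_enc_labelled 2 0).
have rc := RC_input (@size_enc_labelled 2 0).
apply: wcrlg_of_test (BC_wc_bip vs rc) _ => G VG.
have [h Hh] : exists h : 'I_(projT1 G) -> bool, forall u v, (projT2 G).1 u v -> h u != h v.
  by apply/rl_graph2; exists (projT2 G).2; apply: VG.2.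
exact: (wc_bip_testP VG.1 (@matrix_bit_labelled 2 0 G) Hh).
Qed.

Theorem theorem3 :
  (forall r l : nat,
     (r, l) \in [:: (0, 1); (0, 2); (1, 0); (1, 1); (1, 2); (2, 0)] ->
     problem_rlwcg r l) /\
  (forall r l : nat, (r <= 1 \/ (r = 2 /\ l = 0)) -> problem_wcrlg r l).
Proof.
split=> [r l|r l [|[-> ->]]]; last exact: wcrlg20.
  rewrite !inE => /or4P[/eqP[-> ->]|/eqP[-> ->]|/eqP[-> ->]|/or3P[] /eqP[-> ->]].
  - exact: rlwcg0.
  - exact: rlwcg0.
  - exact: rlwcg1.
  - exact: rlwcg1.
  - exact: rlwcg1.
  - exact: rlwcg20.
by case: r => [|[|//]] _; [exact: wcrlg0 | exact: wcrlg1].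
Qed.
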